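(* Let $0<p<1/2$, and set $\alpha=\frac{p+(1-p)\log(1-p)}{2(1-p)p^2}$ and $c=4p(1-p)$, and assume $c<1/2$. Then the output $SOL$ of the KickNext algorithm with parameter $p$ satisfies $$\mathbb E[w(SOL)]\ge p\left(1-\frac{2\alpha c}{(1-c)^2}\right)w(\mathrm{OPT}).$$
   Context: Let $U$ be a finite ground set, $n=|U|$, with weight function $w:U\to\mathbb{R}_{\ge0}$ taking pairwise distinct values; for $X\subseteq U$, $w(X)=\sum_{x\in X}w(x)$. Let $\mathcal F$ be a laminar family of subsets of $U$ (for any $A,B\in\mathcal F$: $A\subseteq B$, $B\subseteq A$, or $A\cap B=\emptyset$) with $U\in\mathcal F$; each $A\in\mathcal F$ has a positive integer capacity $\mu(A)$, with $\mu(A)<\mu(B)$ whenever $A\subsetneq B$. A set $X\subseteq U$ is independent iff $|X\cap A|\le\mu(A)$ for all $A\in\mathcal F$. For $i\in U$, $M(i)$ denotes the minimal member of $\mathcal F$ containing $i$. For $A\subseteq B$ in $\mathcal F$, $\mathrm{Chain}[A,B]$ is the sequence of all $B'\in\mathcal F$ with $A\subseteq B'\subseteq B$, ordered by inclusion from $A$ up to $B$. For $V\subseteq U$ and $B\in\mathcal F$, $\mathrm{OPT}_V(B)$ is the maximum-weight independent subset of $V\cap B$; $\mathrm{OPT}=\mathrm{OPT}_U(U)$. Random model: a uniformly random ordering $\pi$ of $U$ is drawn and, independently, $t\sim\mathrm{Binom}(n,1-p)$; $S=\{\pi(1),\dots,\pi(t)\}$ and $T=U\setminus S$. KickNext algorithm: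 for each $B\in\mathcal F$ initialize $R(B)=\mathrm{OPT}_S(B)$ and $SOL(B)=\emptyset$. Process the elements $i\in T$ in the order $\pi$; for each such $i$, visit the sets $B\in\mathrm{Chain}[M(i),U]$ in order from $M(i)$ upward; at each visited $B$: if $R(B)$ contains an element of weight less than $w(i)$, add $i$ to $SOL(B)$, remove from $R(B)$ the element of largest weight among those of weight less than $w(i)$, and continue to the next set in the chain; otherwise stop processing $i$. The output is $SOL=SOL(U)$. Standing convention of the paper: by padding $U$ with dummy elements of infinitesimal weight, one assumes $|\mathrm{OPT}_S(B)|=\mu(B)$ for every $B\in\mathcal F$. *)

(* Defs.v *)
From Stdlib Require Import Reals Binomial.
From mathcomp Require Import all_boot all_fingroup.

(* mathcomp rebinds %R to ring_scope; use %Re for Stdlib reals. *)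
Delimit Scope R_scope with Re.

Set Implicit Arguments.
Unset Strict Implicit.
Unset Printing Implicit Defensive.

Section KickNext.

Variable U : finType.
Variable w : U -> R.
Variable F : {set {set U}}.
Variable mu : {set U} -> nat.

Definition rltb (x y : R) : bool := if Rlt_dec x y then true else false.

Definition wset (X : {set U}) : R := foldr Rplus 0%Re (map w (enum X)).

Definition laminar : Prop :=
  forall A B, A \in F -> B \in F ->
    [|| A \subset B, B \subset A | [disjoint A & B]].

Definition indep (X : {set U}) : bool :=
  [forall A in F, #|X :&: A| <= mu A].

Definition is_opt (V B X : {set U}) : Prop :=
  indep X /\ X \subset V :&: B /\
  (forall Y, indep Y -> Y \subset V :&: B -> (wset Y <= wset X)%Re).

Definition Mset (i : U) : {set U} :=
  [arg min_(B < setT | (B \in F) && (i \in B)) #|B|].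

(* Chain[A,B]: members B' of F with A ⊆ B' ⊆ B, ordered by inclusion
   (they form a chain, ordered here by increasing cardinality). *)
Definition Chain (A B : {set U}) : seq {set U} :=
  path.sort (fun X Y : {set U} => #|X| <= #|Y|)
       (enum [set B' in F | (A \subset B') && (B' \subset B)]).

(* Algorithm state. R(B) is stored as (real elements, number of dummy
   padding elements); dummies have infinitesimal weight, below all real ones. *)
Record state := State { Rst : {set U} -> seq U * nat ; SOLst : {set U} -> {set U} }.

Definition upd {T : Type} (f : {set U} -> T) (B : {set U}) (v : T) :=
  fun B' => if B' == B then v else f B'.

Definition argmaxw (x0 : U) (s : seq U) : U :=
  foldl (fun a y => if rltb (w a) (w y) then y else a) x0 s.

Definition visit (i : U) (B : {set U}) (st : state) : option state :=
  let (rl, d) := Rst st B in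
  match [seq x <- rl | rltb (w x) (w i)] with
  | x0 :: s =>
      let m := argmaxw x0 s in
      Some (State (upd (Rst st) B (rem m rl, d)) (upd (SOLst st) B (i |: SOLst st B)))
  | [::] =>
      if (0 < d)%N then
        Some (State (upd (Rst st) B (rl, d.-1)) (upd (SOLst st) B (i |: SOLst st B)))
      else None
  end.

Definition process (i : U) (st : state) : state :=
  (foldl (fun (sa : state * bool) B =>
            if sa.2 then
              match visit i B sa.1 with
              | Some st' => (st', true)
              | None => (sa.1, false)
              end
            else sa)
         (st, true) (Chain (Mset i) setT)).1.

Variable opt : {set U} -> {set U} -> {set U}.

Definition init (S : {set U}) : state :=
  State (fun B => (enum (opt S B), (mu B - #|opt S B|)%N)) (fun _ => set0).

Definition order (sigma : {perm U}) : seq U := map sigma (enum U).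

Definition SOL (sigma : {perm U}) (t : nat) : {set U} :=
  let S := [set x in take t (order sigma)] in
  SOLst (foldl (fun st i => process i st) (init S) (drop t (order sigma))) setT.

Definition expected_wSOL (p : R) : R :=
  let n := #|U| in
  foldr Rplus 0%Re
    (map (fun sigma : {perm U} =>
       (/ INR (Factorial.fact n) *
        foldr Rplus 0%Re
          (map (fun t => C n t * (1 - p) ^ t * p ^ (n - t) * wset (SOL sigma t))%Re
               (iota 0 n.+1)))%Re)
       (enum [set: {perm U}])).

End KickNext.

(* Main.v *)
Require Import Defs.
From Stdlib Require Import Reals Binomial.
From mathcomp Require Import all_boot all_fingroup all_order all_algebra.
From mathcomp Require Import Rstruct.
From Coquelicot Require Import Coquelicot.
Set Implicit Arguments.
Unset Strict Implicit.
Unset Printing Implicit Defensive.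
Import GRing.Theory Num.Theory Order.TTheory.

(** Fix [i] in OPT. It lies in T with probability p, and if it lies in T but misses SOL, then some
    [B] containing [i] had nothing lighter than [i] left in R(B) when [i] arrived. With kappa = p +
    (1-p) ln(1-p), the probability of each such event is at most 2 kappa c^s, where s ([slack]) is
    mu(B) - 1 minus the number of elements of OPT in [B] heavier than [i].

    To see this, rejection is first turned into a property of a random walk. A kick removes the
    heaviest element lighter than the newcomer. Read the rest of [B] by decreasing weight, collect
    the sampled elements greedily into an independent set I, and let d be the surplus of early
    elements of T over sampled ones, counting only those that can extend I.

    The law of the walk is exact: restricted to [i] in T, the random order amounts to drawing y from
    [0,p] with density dy and then colouring the other elements independently, sampled with
    probability 1-p, early with y, late with p-y ([perm_mean_RInt]). A counted element is early with
    probability q = y/(1-p+y) < p < 1/2, so the walk drifts down. A supersolution of its recursion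
    bounds the probability of the event ([Ecol_walk]), and explicit exponentials give 2 q c^s
    ([supersol_exists]). Integrating over y gives 2 kappa c^s.

    The losses are then amortised ([weighted_slack]): the sum of w(i) c^s over [i] in OPT and [B]
    containing [i] is at most 2 w(OPT)/(1-c)^2. Abel summation reduces this to counting over sets Y
    of heaviest elements of OPT. Within one [B] the exponents are distinct; sets with the same trace
    on Y form a chain of increasing capacities; and a laminar family has at most 2|Y| nonempty
    traces on Y. The total loss is 4 kappa w(OPT)/(1-c)^2, which is p times 2 alpha c/(1-c)^2 times
    w(OPT). *)

(** * Two integrals *)

Lemma is_RInt_beta (p : R) (c b : nat) :
  is_RInt (fun y => (y ^ c * (p - y) ^ b)%Re) 0%Re p
    (INR (Factorial.fact c) * INR (Factorial.fact b) / INR (Factorial.fact (c + b).+1) * p ^ (c + b).+1)%Re.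
Proof.
have S0 n : INR n.+1 <> 0%Re by apply: not_0_INR.
have F0 n : INR (Factorial.fact n) <> 0%Re by apply: INR_fact_neq_0.
have D n : INR (Factorial.fact n.+1) = (INR n.+1 * INR (Factorial.fact n))%Re.
  by rewrite -mult_INR.
elim: b c => [|b IH] c.
  have -> : (INR (Factorial.fact c) * INR (Factorial.fact 0) / INR (Factorial.fact (c + 0).+1) * p ^ (c + 0).+1)%Re
    = minus (p ^ c.+1 / INR c.+1)%Re (0 ^ c.+1 / INR c.+1)%Re.
    rewrite addn0 D /minus /plus /opp /=; field; do ?split; (exact: F0 || exact: S0).
  apply: (is_RInt_ext (fun y => (INR c.+1 * y ^ c / INR c.+1)%Re)).
    by move=> x _; rewrite /=; field; apply: S0.
  apply: (is_RInt_derive (fun y => (y ^ c.+1 / INR c.+1)%Re)) => x _.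
    by auto_derive => //; rewrite /=; field; apply: S0.
  by apply: ex_derive_continuous; auto_derive.
(* Integration by parts: the integrand is the derivative of [y^(c+1) (p-y)^(b+1) / (c+1)], which
   vanishes at both ends. *)
have h1 : is_RInt (fun y => y ^ c * (p - y) ^ b.+1
     - INR b.+1 / INR c.+1 * (y ^ c.+1 * (p - y) ^ b))%Re 0%Re p 0%Re.
  have {2}-> : (0 = minus (p ^ c.+1 * (p - p) ^ b.+1 / INR c.+1)
                     (0 ^ c.+1 * (p - 0) ^ b.+1 / INR c.+1))%Re.
    by rewrite /minus /plus /opp /=; field; apply: S0.
  apply: (is_RInt_derive (fun y => (y ^ c.+1 * (p - y) ^ b.+1 / INR c.+1)%Re)) => x _.
    by auto_derive => //; rewrite -/(INR c.+1) -/(INR b.+1) -!tech_pow_Rmult /Rminus; field; apply: S0.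
  by apply: ex_derive_continuous; auto_derive.
have h2 := is_RInt_scal _ _ _ (INR b.+1 / INR c.+1)%Re _ (IH c.+1).
have h3 := is_RInt_plus _ _ _ _ _ _ h1 h2.
have -> : (INR (Factorial.fact c) * INR (Factorial.fact b.+1)
    / INR (Factorial.fact (c + b.+1).+1) * p ^ (c + b.+1).+1)%Re
  = (0 + INR b.+1 / INR c.+1 * (INR (Factorial.fact c.+1) * INR (Factorial.fact b)
    / INR (Factorial.fact (c.+1 + b).+1) * p ^ (c.+1 + b).+1))%Re.
  rewrite addnS addSn (D c) (D b); field.
  by do ?split; (exact: S0 || exact: F0).
apply: is_RInt_ext h3 => x _; rewrite /plus /scal /= /mult /=; ring.
Qed.

Lemma is_RInt_ratio (p : R) : (0 < p < 1)%Re ->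
  is_RInt (fun y => y / (1 - p + y))%Re 0%Re p (p + (1 - p) * ln (1 - p))%Re.
Proof.
move=> [p0 p1].
have -> : (p + (1 - p) * ln (1 - p))%Re =
    minus (p - (1 - p) * ln (1 - p + p)) (0 - (1 - p) * ln (1 - p + 0))%Re.
  have -> : (1 - p + p = 1)%Re by ring.
  by rewrite ln_1 Rplus_0_r /minus /plus /opp /=; ring.
apply: (is_RInt_derive (fun y => y - (1 - p) * ln (1 - p + y))%Re) => x;
  rewrite Rmin_left ?Rmax_right; try exact: Rlt_le; move=> [x0 xp].
  by auto_derive; [|field]; Lra.lra.
by apply: ex_derive_continuous; auto_derive; Lra.lra.
Qed.

(* Loaded only here because it rebinds [ring] and [field], which must act on Stdlib terms above. *)
From mathcomp Require Import ring lra zify.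
Local Open Scope nat_scope.

(** * Augmentation and exchange in laminar matroids *)

Section LaminarMatroid.
Variables (U : finType) (F : {set {set U}}) (mu : {set U} -> nat).
Hypothesis lamF : laminar F.
Implicit Types (X Y A B : {set U}) (x y : U).
Local Notation indep := (indep F mu).

Lemma indepP X :
  reflect (forall A, A \in F -> #|X :&: A| <= mu A) (indep X).
Proof. exact: 'forall_implyP. Qed.

Lemma indepS X Y : X \subset Y -> indep Y -> indep X.
Proof.
move=> XY /indepP iY; apply/indepP => A AF.
by apply: leq_trans (iY _ AF); apply: subset_leq_card; apply: setSI.
Qed.

Lemma indep_setU1 X y : indep X ->
  (forall A, A \in F -> y \in A -> #|X :&: A| < mu A) -> indep (y |: X).
Proof.
move=> /indepP iX H; apply/indepP => A AF; rewrite setIUl.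
case: (boolP (y \in A)) => yA.
  apply: leq_trans (leq_card_setU _ _) _.
  have -> : [set y] :&: A = [set y] by apply/setIidPl; rewrite sub1set.
  by rewrite cards1 add1n; exact: H.
have -> : [set y] :&: A = set0.
  by apply/setP => z; rewrite !inE; case: eqP => // ->; rewrite (negbTE yA).
by rewrite set0U; apply: iX.
Qed.

Lemma indep_ltn X y A : indep (y |: X) -> y \notin X -> A \in F -> y \in A ->
  #|X :&: A| < mu A.
Proof.
move=> /indepP iX yX AF yA; apply: leq_trans (iX _ AF).
have -> : (y |: X) :&: A = y |: (X :&: A).
  by apply/setP => z; rewrite !inE; case: eqP => // ->; rewrite yA.
by rewrite cardsU1 !inE (negbTE yX) /= add1n.
Qed.

Lemma card_cover_trivIset (P : {set {set U}}) X : trivIset P ->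
  #|X :&: cover P| = \sum_(A in P) #|X :&: A|.
Proof.
move=> tP.
have E A : #|X :&: A| = \sum_(x in A) (x \in X : nat).
  rewrite -sum1_card big_mkcond [RHS]big_mkcond /=.
  by apply: eq_bigr => x _; rewrite inE; case: (x \in X); case: (x \in A).
rewrite E (big_trivIset _ tP).
by apply: eq_bigr => A _; rewrite E.
Qed.

(* The maximal tight sets of X are disjoint; if nothing can be added, they cover Y :\: X. *)
Lemma indep_augment X Y : indep X -> indep Y -> #|X| < #|Y| ->
  exists2 y, y \in Y :\: X & indep (y |: X).
Proof.
move=> iX iY; rewrite ltnNge => /negP ltXY.
case: (boolP [exists y in Y :\: X, indep (y |: X)]) => [/exists_inP[y ? ?]|].
  by exists y.
rewrite negb_exists_in => /forall_inP H; case: ltXY.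
pose tight A := (A \in F) && (#|X :&: A| == mu A).
pose P := [set A | maxset tight A].
have Pt A : A \in P -> tight A by rewrite inE => /maxsetp.
have tP : trivIset P.
  apply/trivIsetP => A B AP BP AB.
  have /andP[AF _] := Pt _ AP; have /andP[BF _] := Pt _ BP.
  move: AP BP; rewrite !inE => mA mB.
  case/or3P: (lamF AF BF) => // S.
    by move: AB; rewrite (maxsetsup mA (maxsetp mB) S) eqxx.
  by move: AB; rewrite (maxsetsup mB (maxsetp mA) S) eqxx.
have cov : Y :\: X \subset cover P.
  apply/subsetP => y yYX.
  have dep := H _ yYX; have [A AF /andP[yA tA]] :
      exists2 A, A \in F & (y \in A) && (#|X :&: A| == mu A).
    case: (boolP [exists A in F, (y \in A) && (#|X :&: A| == mu A)]).
      by case/exists_inP => A AF ?; exists A.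
    rewrite negb_exists_in => /forall_inP nA; case/negP: dep.
    apply: indep_setU1 => // A AF yA; move: (nA _ AF); rewrite yA /=.
    by rewrite ltn_neqAle => -> /=; move/indepP: iX; apply.
  have [M mM AM] := @maxset_exists _ tight A (introT andP (conj AF tA)).
  by apply/bigcupP; exists M; rewrite ?inE // (subsetP AM).
rewrite -(cardsID (cover P) Y) -(cardsID (cover P) X); apply: leq_add.
  rewrite !(card_cover_trivIset _ tP); apply: leq_sum => A /Pt /andP[AF /eqP ->].
  by move/indepP: iY; apply.
apply: subset_leq_card; apply/subsetP => y; rewrite !inE => /andP[yc yY].
rewrite yc /=; apply: contraR yc => yX.
by apply: (subsetP cov); rewrite inE yX.
Qed.

(* Exchange: e is taken in the smallest tight set of X around y. *)
Lemma indep_exchange X y (H : pred U) : indep X ->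
  indep (y |: [set x in X | H x]) -> y \notin X ->
  indep (y |: X) \/ exists e, [/\ e \in X, ~~ H e & indep (y |: (X :\ e))].
Proof.
move=> iX iyH yX.
pose tight A := [&& A \in F, y \in A & #|X :&: A| == mu A].
case: (boolP [exists A, tight A]) => [/existsP[A0 tA0]|nt]; last first.
  left; apply: indep_setU1 => // A AF yA; move: nt; rewrite negb_exists.
  move=> /forallP /(_ A); rewrite /tight AF yA /= ltn_neqAle => -> /=.
  by move/indepP: iX; apply.
right; have [M mM _] := minset_exists tA0.
have /and3P[MF yM /eqP tM] := minsetp mM.
have : ~~ (X :&: M \subset [set x in X | H x]).
  apply/negP => S.
  have : #|[set x in X | H x] :&: M| < mu M.
    by apply: indep_ltn iyH _ MF yM; rewrite inE (negbTE yX).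
  rewrite ltnNge -tM => /negP; apply; apply: subset_leq_card.
  by rewrite subsetI S subsetIr.
case/subsetPn => e; rewrite !inE => /andP[eX eM]; rewrite eX /= => He.
exists e; split=> //; apply: indep_setU1; first exact: indepS (subD1set _ _) iX.
move=> A AF yA; case: (boolP (#|X :&: A| == mu A)) => tA; last first.
  apply: leq_ltn_trans (_ : _ <= #|X :&: A|) _.
    by apply: subset_leq_card; apply: setSI; apply: subD1set.
  by rewrite ltn_neqAle tA; move/indepP: iX; apply.
have tightA : tight A by rewrite /tight AF yA tA.
have MA : M \subset A.
  case/or3P: (lamF MF AF) => // S.
    by rewrite (minsetinf mM tightA S) subxx.
  by move/pred0P: S => /(_ y); rewrite /= yM yA.
rewrite -(eqP tA) -[X in _ < X](cardsID [set e]).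
have -> : (X :&: A) :&: [set e] = [set e].
  by apply/setIidPr; rewrite sub1set inE eX (subsetP MA).
rewrite cards1 add1n ltnS; apply: subset_leq_card.
by apply/subsetP => z; rewrite !inE => /andP[/andP[-> ->] ->].
Qed.

End LaminarMatroid.

(** * Optimal sets are greedy *)

Section OptimalSets.
Variables (U : finType) (w : U -> R) (F : {set {set U}}) (mu : {set U} -> nat).
Hypothesis lamF : laminar F.
Hypothesis w_ge0 : forall x, (0 <= w x)%R.
Hypothesis w_inj : injective w.
Implicit Types (X Y A B V O : {set U}) (x y i : U).
Local Notation indep := (indep F mu).
Local Notation is_opt := (is_opt w F mu).

Lemma foldr_Rplus (T : Type) (f : T -> R) (s : seq T) :
  foldr Rplus 0%Re (map f s) = (\sum_(x <- s) f x)%R.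
Proof. by elim: s => [|x s IH] /=; rewrite ?big_nil // big_cons IH. Qed.

Lemma wsetE X : wset w X = (\sum_(x in X) w x)%R.
Proof. by rewrite /wset foldr_Rplus big_enum. Qed.

Lemma is_optP V B O : is_opt V B O ->
  [/\ indep O, O \subset V :&: B
    & forall Y, indep Y -> Y \subset V :&: B ->
        (\sum_(x in Y) w x <= \sum_(x in O) w x)%R].
Proof.
case=> iO [OVB maxO]; split=> // Y iY YVB.
by apply/RleP; rewrite -!wsetE; apply: maxO.
Qed.

(** Were [y] left out, it could be added to [O] or exchanged for a strictly lighter element, with a
    gain in weight. Positivity of [w y] makes the first case a gain: an optimum may omit weightless
    elements. *)
Lemma opt_greedy V B O y : is_opt V B O -> y \in V -> y \in B ->
  (0 < w y)%R -> indep (y |: [set x in O | (w y < w x)%R]) -> y \in O.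
Proof.
move=> /is_optP[iO OVB maxO] yV yB wy iy; apply/negPn/negP => yO.
have yVB : [set y] \subset V :&: B by rewrite sub1set inE yV.
case: (indep_exchange lamF (H := fun x => (w y < w x)%R) iO iy yO) => [iyO|].
  have := maxO _ iyO; rewrite subUset yVB => /(_ OVB).
  by rewrite big_setU1 //=; lra.
case=> e [eO + ie]; rewrite -leNgt => we.
have ney : e != y by apply: contraNneq yO => <-.
have lt_ey : (w e < w y)%R.
  by rewrite lt_neqAle we andbT; apply: contraNneq ney => /w_inj ->.
have := maxO _ ie; rewrite subUset yVB (subset_trans (subD1set _ _) OVB).
move=> /(_ isT); rewrite big_setU1 ?inE ?(negbTE yO) ?andbF //=.
by rewrite [X in (_ <= X)%R](big_setD1 e) //=; lra.
Qed.

(** Otherwise some [y] of [Y] augments the part of [O] above [xi], but greediness already puts that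
    [y] in [O]. *)
Lemma opt_card_max V B O (xi : R) Y : is_opt V B O -> (0 <= xi)%R ->
  indep Y -> Y \subset V :&: B -> (forall y, y \in Y -> (xi < w y)%R) ->
  #|Y| <= #|[set x in O | (xi < w x)%R]|.
Proof.
move=> optO xi0 iY YVB Yxi; rewrite leqNgt; apply/negP => lt.
have [iO _ _] := is_optP optO.
have iO' : indep [set x in O | (xi < w x)%R].
  by apply: indepS iO; apply/subsetP => x; rewrite inE => /andP[].
have [y] := indep_augment lamF iO' iY lt.
rewrite 2!inE => /andP[+ yY] iy.
have := subsetP YVB _ yY; rewrite inE => /andP[yV yB].
rewrite Yxi // andbT => /negP; apply.
apply: (opt_greedy optO) => //; first exact: le_lt_trans (Yxi _ yY).
apply: indepS iy; apply: setUS; apply/subsetP => x; rewrite !inE.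
by case/andP=> -> /(lt_trans (Yxi _ yY)) ->.
Qed.

(** Members of [F] above [B] do not obstruct the augmentation: [i], being in [O], occupies in each
    of them a place that the heavier elements of [O :&: B] leave free. *)
Lemma opt_card_max_in O i B Y : is_opt [set: U] [set: U] O -> i \in O ->
  B \in F -> i \in B -> indep Y -> Y \subset B ->
  (forall y, y \in Y -> (w i < w y)%R) ->
  #|Y| <= #|[set x in O :&: B | (w i < w x)%R]|.
Proof.
move=> optO iO BF iB iY YB Yi; rewrite leqNgt; apply/negP => lt.
have [indO _ _] := is_optP optO.
have iO' : indep [set x in O :&: B | (w i < w x)%R].
  by apply: indepS indO; apply/subsetP => x; rewrite !inE -andbA => /andP[].
have [y] := indep_augment lamF iO' iY lt.
rewrite 2!inE => /andP[+ yY] iy.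
have wiy := Yi _ yY; have yB := subsetP YB _ yY.
rewrite inE yB wiy !andbT => yO.
have wy : (0 < w y)%R by apply: le_lt_trans wiy.
have /negP : y \notin O by [].
apply; apply: (opt_greedy optO) => //; apply: (@indepS _ _ _ _ (y |: [set x in O | (w i < w x)%R])).
  apply: setUS; apply/subsetP => x; rewrite !inE.
  by case/andP=> -> /(lt_trans wiy) ->.
apply: indep_setU1.
  by apply: indepS indO; apply/subsetP => x; rewrite !inE => /andP[].
move=> A AF yA; case/or3P: (lamF AF BF) => S.
- have <- : [set x in O :&: B | (w i < w x)%R] :&: A =
      [set x in O | (w i < w x)%R] :&: A.
    apply/setP => x; rewrite !inE; case: (boolP (x \in A)) => [xA|]; rewrite ?andbF //.
    by rewrite (subsetP S _ xA) !andbT.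
  by apply: indep_ltn iy _ AF yA; rewrite !inE (negbTE yO).
- have := indepP _ _ _ indO _ AF; apply: leq_trans.
  apply: proper_card; apply/properP; split.
    by apply/subsetP => x; rewrite !inE => /andP[/andP[-> _] ->].
  by exists i; rewrite !inE ?iO ?(subsetP S) ?ltxx ?andbF.
by move/pred0P: S => /(_ y); rewrite /= yA yB.
Qed.

End OptimalSets.

(** * One arrival, and the invariant of R(B) and SOL(B) *)

Section Algorithm.
Variables (U : finType) (w : U -> R) (F : {set {set U}}) (mu : {set U} -> nat).
Variable opt : {set U} -> {set U} -> {set U}.
Hypothesis lamF : laminar F.
Hypothesis setTF : [set: U] \in F.
Hypothesis w_ge0 : forall x, (0 <= w x)%R.
Hypothesis w_inj : injective w.
Hypothesis optP : forall V B, is_opt w F mu V B (opt V B).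
Implicit Types (S C X Y A B V O : {set U}) (x y i j : U).

Lemma rltbE (a b : R) : rltb a b = (a < b)%R.
Proof.
rewrite /rltb; case: Rlt_dec => h; apply/esym; first exact/RltP.
by apply/negbTE/negP => /RltP.
Qed.

Lemma card_opt S B : B \in F -> #|opt S B| <= mu B.
Proof.
move=> BF; have [iO OB _] := is_optP (optP S B).
have := indepP _ _ _ iO _ BF; suff -> : opt S B :&: B = opt S B by [].
by apply/setIidPl; apply: subset_trans OB (subsetIr _ _).
Qed.

Definition can_kick i (r : seq U * nat) : bool :=
  has (fun x => (w x < w i)%R) r.1 || (0 < r.2).

Inductive kick i : seq U * nat -> seq U * nat -> Prop :=
| KickReal rl d m : m \in rl -> (w m < w i)%R ->
    (forall x, x \in rl -> (w x < w i)%R -> (w x <= w m)%R) ->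
    kick i (rl, d) (rem m rl, d)
| KickDummy rl d : (forall x, x \in rl -> (w i <= w x)%R) ->
    kick i (rl, d.+1) (rl, d).

Lemma kick_can_kick i r r' : kick i r r' -> can_kick i r.
Proof.
case=> [rl d m mr mi _|rl d _]; rewrite /can_kick /= ?orbT //.
by apply/orP; left; apply/hasP; exists m.
Qed.

Lemma argmaxwP x0 s : argmaxw w x0 s \in x0 :: s /\
  forall x, x \in x0 :: s -> (w x <= w (argmaxw w x0 s))%R.
Proof.
elim: s x0 => [|y s IH] x0 /=; first by split=> [|x]; rewrite inE // => /eqP ->.
rewrite rltbE; case: ltP => [lt|le].
  have [m1 m2] := IH y; split=> [|x]; first by rewrite inE m1 orbT.
  rewrite inE => /predU1P[->|/m2 //]; apply: le_trans (ltW lt) _.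
  by apply: m2; rewrite mem_head.
have [m1 m2] := IH x0; split=> [|x].
  by move: m1; rewrite !inE => /orP[->|->]; rewrite ?orbT.
rewrite !inE => /or3P[/eqP ->|/eqP ->|xs].
- by apply: m2; rewrite mem_head.
- by apply: le_trans le _; apply: m2; rewrite mem_head.
- by apply: m2; rewrite inE xs orbT.
Qed.

Variant visit_spec i B (st : state U) : option (state U) -> Prop :=
| VisitSome st' of kick i (Rst st B) (Rst st' B)
    & SOLst st' B = i |: SOLst st B
    & (forall A, A != B -> Rst st' A = Rst st A /\ SOLst st' A = SOLst st A) :
    visit_spec i B st (Some st')
| VisitNone of ~~ can_kick i (Rst st B) : visit_spec i B st None.

Lemma visitP i B st : visit_spec i B st (visit w i B st).
Proof.
rewrite /visit; case E: (Rst st B) => [rl d].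
have memf x : (x \in [seq y <- rl | rltb (w y) (w i)]) =
              (w x < w i)%R && (x \in rl) by rewrite mem_filter rltbE.
case Ef: [seq x <- rl | rltb (w x) (w i)] memf => [|x0 s] memf; last first.
  have [m1 m2] := argmaxwP x0 s.
  move: m1; rewrite memf => /andP[mi mr].
  constructor=> /=; rewrite /upd ?eqxx ?E //; last by move=> A /negbTE ->.
  by apply: KickReal => // x xr xi; apply: m2; rewrite memf xi.
have none x : x \in rl -> (w i <= w x)%R.
  by move=> xr; rewrite leNgt; apply/negP => xi; have := memf x; rewrite xi xr.
case: d E => [|d] E /=.
  constructor; rewrite /can_kick E orbF; apply/hasPn => x /none.
  by rewrite leNgt.
constructor=> /=; rewrite /upd ?eqxx ?E //; last by move=> A /negbTE ->.
exact: KickDummy.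
Qed.

(** The function folded by [process], named so that the two are convertible. *)
Definition visit_step i (sa : state U * bool) B :=
  if sa.2 then
    match visit w i B sa.1 with
    | Some st' => (st', true)
    | None => (sa.1, false)
    end
  else sa.

Lemma foldl_visit_false i st l : foldl (visit_step i) (st, false) l = (st, false).
Proof. by elim: l. Qed.

(** A visit touches only its own set and the chain has no repetition, so every kick, and the refusal
    that may end the chain, can be described in the state before [i] arrived. *)
Lemma foldl_visitP i st (l : seq {set U}) : uniq l ->
  exists l1 l2, let st' := (foldl (visit_step i) (st, true) l).1 in
  [/\ l = l1 ++ l2,
      l2 = [::] \/ (exists2 B, B \in l & ~~ can_kick i (Rst st B)),
      forall B, B \notin l1 -> Rst st' B = Rst st B /\ SOLst st' B = SOLst st B
    & forall B, B \in l1 -> kick i (Rst st B) (Rst st' B) /\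
        SOLst st' B = i |: SOLst st B].
Proof.
elim: l st => [|B l IH] st /=; first by exists [::], [::]; split=> //; left.
case/andP=> Bl ul; rewrite {2 4 6 8}/visit_step /=.
case: visitP => [st1 kB sB other|nk]; last first.
  rewrite foldl_visit_false /=; exists [::], (B :: l); split=> //.
  by right; exists B; rewrite ?mem_head.
have [l1 [l2 [El stop unch ch]]] := IH st1 ul.
have Bl1 : B \notin l1 by apply: contra Bl; rewrite El mem_cat => ->.
exists (B :: l1), l2; split=> /=.
- by rewrite {1}El.
- case: stop => [|[A Al nk]]; [by left|right]; exists A.
    by rewrite inE Al orbT.
  by have [<- _] := other A (contraNneq (fun E => eq_ind _ (fun X => X \in l) Al _ E) Bl).
- move=> A; rewrite inE negb_or => /andP[AB /unch[-> ->]]; exact: other.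
- move=> A; rewrite inE; case: eqVneq => [-> _|AB /= Al1].
    by have [-> ->] := unch _ Bl1.
  by have [k s] := ch _ Al1; have [<- <-] := other _ AB.
Qed.

Lemma MsetP i : [/\ Mset F i \in F, i \in Mset F i
  & forall A, A \in F -> i \in A -> Mset F i \subset A].
Proof.
rewrite /Mset; case: arg_minnP => [|M /andP[MF iM] minM].
  by rewrite setTF inE.
split=> // A AF iA; case/or3P: (lamF MF AF) => // S.
  have : #|M| <= #|A| by apply: minM; rewrite AF iA.
  by rewrite (geq_leqif (subset_leqif_cards S)) => /eqP ->.
by move/pred0P: S => /(_ i); rewrite /= iM iA.
Qed.

Lemma mem_Chain i A : (A \in Chain F (Mset F i) [set: U]) = (A \in F) && (i \in A).
Proof.
rewrite mem_sort mem_enum inE subsetT andbT; have [MF iM minM] := MsetP i.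
case AF: (A \in F) => //=; apply/idP/idP => [/subsetP -> //|]; exact: minM.
Qed.

Lemma Chain_uniq i : uniq (Chain F (Mset F i) [set: U]).
Proof. by rewrite sort_uniq enum_uniq. Qed.

Lemma Chain_cat_card i l1 l2 A B : Chain F (Mset F i) [set: U] = l1 ++ l2 ->
  A \in l2 -> B \in l1 -> #|B| <= #|A|.
Proof.
move=> E Al Bl; have tot : total (fun X Y : {set U} => #|X| <= #|Y|).
  by move=> X Y; apply: leq_total.
have := sort_sorted tot (enum [set B' in F | (Mset F i \subset B') && (B' \subset [set: U])]).
rewrite -/(Chain F (Mset F i) setT) E sorted_pairwise; last first.
  by move=> X Y Z; apply: leq_trans.
by rewrite pairwise_cat => /and3P[/allrelP H _ _]; apply: H.
Qed.

(** By greediness the left side is the largest size of an independent set of sampled elements of [A]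
    heavier than [j]; so such elements cannot fill [A]. *)
Definition low_rank_at S j A := #|[set x in opt S A | (w j < w x)%R]| < mu A.

(* The dummies of R(B) are counted by the windows with [xi < 0]: they lie below every real element. *)
Record Binv S C B (r : seq U * nat) X : Prop := BInv {
  Binv_uniq : uniq r.1;
  Binv_sub : {subset r.1 <= opt S B};
  Binv_dummy : r.2 <= mu B - #|opt S B|;
  Binv_SOL : {subset X <= C};
  Binv_SOL_sub : {subset X <= B};
  Binv_low : forall j A, j \in X -> A \in F -> j \in A -> A \subset B ->
    low_rank_at S j A;
  Binv_count : forall theta xi : R,
    (exists2 v, v \in r.1 & w v = theta) \/ (forall y, (w y < theta)%R) ->
    #|[set e in opt S B | (e \notin r.1) && (xi <= w e < theta)%R]|
      + (if (xi < 0)%R then mu B - #|opt S B| - r.2 else 0)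
    <= #|[set j in X | (xi < w j < theta)%R]| }.

Lemma Binv_init S B : Binv S set0 B (enum (opt S B), mu B - #|opt S B|) set0.
Proof.
split=> //=; first exact: enum_uniq.
- by move=> x; rewrite mem_enum.
- by move=> x; rewrite inE.
- by move=> j A; rewrite inE.
move=> theta xi _; rewrite subnn if_same addn0 eq_card0 // => e.
by rewrite !inE mem_enum; case: (e \in opt S B).
Qed.

Lemma Binv_monoC S C C' B r X : {subset C <= C'} -> Binv S C B r X -> Binv S C' B r X.
Proof. by move=> CC' [? ? ? XC ? ? ?]; split=> // x /XC /CC'. Qed.

Lemma card_setU1_window j X (xi theta : R) : j \notin X -> (xi < w j < theta)%R ->
  #|[set x in j |: X | (xi < w x < theta)%R]| =
  #|[set x in X | (xi < w x < theta)%R]|.+1.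
Proof.
move=> jX jw; have -> : [set x in j |: X | (xi < w x < theta)%R] =
    j |: [set x in X | (xi < w x < theta)%R].
  by apply/setP => x; rewrite !inE; case: eqP => //= ->.
by rewrite cardsU1 inE (negbTE jX).
Qed.

(** For the count: if the kicked [m] lies in a window below [theta], so does [j]. It is heavier than
    [m], and it is lighter than any remaining survivor of weight [theta], since it kicked the
    heaviest element below itself. A dummy is kicked only when every survivor outweighs [j], which
    again puts [j] below [theta]. *)
Lemma Binv_kick S C B r r' X j : S \subset ~: C ->  kick j r r' ->
  Binv S C B r X -> j \notin S -> j \notin C -> j \in B ->
  (forall A, A \in F -> j \in A -> A \subset B -> low_rank_at S j A) ->
  Binv S (j |: C) B r' (j |: X).
Proof.
move=> SC k [ru rsub rd XC XB low cnt] jS jC jB jlow.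
have jX : j \notin X by apply: contra jC => /XC.
have OS x : x \in opt S B -> x \in S.
  have [_ /subsetP OB _] := is_optP (optP S B).
  by move/OB; rewrite inE => /andP[].
have subX xi theta : #|[set x in X | (xi < w x < theta)%R]| <=
    #|[set x in j |: X | (xi < w x < theta)%R]|.
  apply: subset_leq_card; apply/subsetP => x; rewrite !inE.
  by case/andP=> -> ->; rewrite orbT.
have neq_w v : v \in opt S B -> w v != w j.
  by move=> /OS vS; apply: contraNneq jS => /w_inj <-.
split.
- by case: k ru => //= rl d m mr _ _ ru; rewrite rem_uniq.
- by case: k ru rsub => //= rl d m mr _ _ ru rsub x /mem_rem /rsub.
- by case: k rd => //= rl d _; apply: leq_trans.
- by move=> x; rewrite !inE => /predU1P[-> |/XC ->]; rewrite ?eqxx ?orbT.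
- by move=> x; rewrite !inE => /predU1P[-> //|/XB ->].
- move=> x A; rewrite !inE => /predU1P[->|xX]; [exact: jlow | exact: low].
move=> theta xi Hth; case: k ru rsub rd cnt Hth => [rl d m mr mj maxm|rl d none] /=
  ru rsub rd cnt Hth; last first.
  have Hj : (w j < theta)%R.
    case: Hth => [[v vr <-]|->] //.
    by rewrite lt_neqAle none // andbT eq_sym neq_w // rsub.
  have := cnt theta xi Hth; case: (ltP xi 0%R) => xi0.
    rewrite card_setU1_window //; last by rewrite Hj (lt_le_trans xi0).
    by move: rd; lia.
  by move=> H; apply: leq_trans H _; apply: subX.
have Hth' : (exists2 v, v \in rl & w v = theta) \/ (forall y, (w y < theta)%R).
  case: Hth => [[v /mem_rem vr <-]|]; [by left; exists v|by right].
have := cnt theta xi Hth'.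
case: (boolP (xi <= w m < theta)%R) => mw; last first.
  move=> H; apply: leq_trans (subX _ _); apply: leq_trans H.
  rewrite leq_add2r; apply: subset_leq_card; apply/subsetP => x; rewrite !inE.
  case/and3P=> -> xr xw; rewrite xw andbT /=; apply: contra xr => xr.
  rewrite mem_rem_uniq // inE xr andbT; apply: contraNneq mw => <-.
  exact: xw.
have jw : (xi < w j < theta)%R.
  case/andP: mw => xm mt; rewrite (le_lt_trans xm mj) /=.
  case: Hth => [[v vr' Ev]|->] //; rewrite -Ev in mt *.
  have vr := mem_rem vr'; rewrite lt_neqAle eq_sym neq_w ?rsub //=.
  rewrite leNgt; apply/negP => vj; have := maxm _ vr vj.
  by rewrite leNgt mt.
rewrite card_setU1_window // -ltnS => H; apply: leq_trans H; rewrite -addSn.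
rewrite leq_add2r; apply: leq_trans (_ : _ <= #|m |: [set e in opt S B |
   (e \notin rl) && (xi <= w e < theta)%R]|) _; last first.
  by rewrite cardsU1; case: (_ \notin _).
apply: subset_leq_card; apply/subsetP => x; rewrite !inE.
rewrite mem_rem_uniq // inE negb_and negbK.
by case: eqVneq => //= _ /and3P[-> -> ->].
Qed.

End Algorithm.

(** * The whole run, and what a rejection leaves behind *)

Section Run.
Variables (U : finType) (w : U -> R) (F : {set {set U}}) (mu : {set U} -> nat).
Variable opt : {set U} -> {set U} -> {set U}.
Hypothesis lamF : laminar F.
Hypothesis setTF : [set: U] \in F.
Hypothesis w_ge0 : forall x, (0 <= w x)%R.
Hypothesis w_inj : injective w.
Hypothesis optP : forall V B, is_opt w F mu V B (opt V B).
Implicit Types (S C X Y A B V O : {set U}) (x y i j : U).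
Local Notation Binv := (Binv w F mu opt).
Local Notation low_rank_at := (low_rank_at w mu opt).

Definition Ginv S C st := forall B, B \in F -> Binv S C B (Rst st B) (SOLst st B).

Lemma can_kick_low S C B r X i : Binv S C B r X -> B \in F -> can_kick w i r ->
  low_rank_at S i B.
Proof.
move=> [_ rsub rd _ _ _ _] BF; have cO := card_opt optP S BF.
have sub : [set x in opt S B | (w i < w x)%R] \subset opt S B.
  by apply/subsetP => x; rewrite inE => /andP[].
case/orP => [/hasP[m mr mi]|d0]; last first.
  apply: leq_ltn_trans (subset_leq_card sub) _; move: d0 rd; lia.
apply: leq_trans cO; apply: proper_card; apply/properP; split=> //.
by exists m; rewrite ?inE ?rsub //= -leNgt ltW.
Qed.

Lemma process_inv S C i st : S \subset ~: C -> Ginv S C st ->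
  i \notin S -> i \notin C ->
  [/\ Ginv S (i |: C) (process w F i st),
      forall B, SOLst st B \subset SOLst (process w F i st) B
    & i \in SOLst (process w F i st) [set: U] \/
      exists B, [/\ B \in F, i \in B & ~~ can_kick w i (Rst st B)]].
Proof.
move=> SC inv iS iC.
have [l1 [l2 /= [E stop unch ch]]] :=
  foldl_visitP w i st (Chain_uniq F i).
rewrite -[foldl _ _ _]/(foldl (visit_step w i) _ _) -/(process w F i st) in unch ch.
have inF B : B \in l1 -> B \in F /\ i \in B.
  move=> Bl; apply/andP; rewrite -(mem_Chain lamF setTF) E.
  by rewrite mem_cat Bl.
split.
- move=> B BF; case: (boolP (B \in l1)) => Bl; last first.
    have [-> ->] := unch _ Bl; apply: Binv_monoC (inv _ BF) => x.
    by rewrite inE => ->; rewrite orbT.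
  have [k ->] := ch _ Bl; have [_ iB] := inF _ Bl.
  apply: (Binv_kick setTF w_ge0 w_inj optP SC k (inv _ BF)) => // A AF iA AB.
  have : A \in l1 ++ l2 by rewrite -E mem_Chain // AF.
  rewrite mem_cat => /orP[Al|Al].
    by have [kA _] := ch _ Al; apply: can_kick_low (inv _ AF) AF (kick_can_kick kA).
  (* A subset [A] of [B] cannot come after [B]: the order by cardinality would force [A = B],
     against uniqueness in the chain. *)
  have := Chain_cat_card E Al Bl; rewrite (geq_leqif (subset_leqif_cards AB)).
  move=> /eqP EA; have := Chain_uniq F i; rewrite E cat_uniq => /and3P[_ /hasPn H _].
  by move: (H _ Al); rewrite EA Bl.
- move=> B; case: (boolP (B \in l1)) => Bl; last by have [_ ->] := unch _ Bl.
  by have [_ ->] := ch _ Bl; apply: subsetUr.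
case: stop => [E2|[B Bl nk]]; last first.
  right; exists B; move: Bl; rewrite mem_Chain // => /andP[BF iB].
  by split.
left; have : setT \in l1 by rewrite -[l1]cats0 -E2 -E mem_Chain // setTF inE.
by move/ch => [_ ->]; rewrite !inE eqxx.
Qed.

Local Notation run := (foldl (fun st i => process w F i st)).

Lemma run_inv S C l st : Ginv S C st -> uniq l -> S \subset ~: C ->
  {in l, forall x, (x \notin S) && (x \notin C)} ->
  Ginv S ([set x in l] :|: C) (run st l) /\
  forall B, SOLst st B \subset SOLst (run st l) B.
Proof.
elim: l C st => [|i l IH] C st inv /=.
  move=> _ _ _; split=> [B BF|//]; apply: Binv_monoC (inv _ BF) => x.
  by rewrite !inE => ->; rewrite orbT.
case/andP=> il ul SC H; have /andP[iS iC] := H i (mem_head _ _).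
have [inv1 sub1 _] := process_inv SC inv iS iC.
have SC1 : S \subset ~: (i |: C).
  apply/subsetP => x xS; rewrite !inE negb_or.
  rewrite (contraNneq _ iS) => [|<- //]; rewrite /=.
  by have := subsetP SC _ xS; rewrite inE.
have [|inv2 sub2] := IH _ _ inv1 ul SC1.
  move=> x xl; have /andP[-> xC] : (x \notin S) && (x \notin C).
    by apply: H; rewrite inE xl orbT.
  by rewrite !inE negb_or xC andbT; apply: contraNneq il => <-.
split=> [B BF|B]; last exact: subset_trans (sub1 B) (sub2 B).
by apply: Binv_monoC (inv2 _ BF) => x; rewrite !inE orbCA orbA.
Qed.

(** The trace of a refusal of [i] at [B], freed from R(B): [C] is the part of T read before [i] and
    [X] the current SOL(B). All of [opt S B] below [theta] has been kicked, and all dummies are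
    used, so the count ranges over everything in the window. *)
Record fails S C i B X (theta : R) : Prop := Fails {
  fails_sub : X \subset C;
  fails_subB : X \subset B;
  fails_low : forall j A, j \in X -> A \in F -> j \in A -> A \subset B ->
    low_rank_at S j A;
  fails_theta : (w i < theta)%R;
  fails_count : forall xi : R,
    #|[set e in opt S B | (xi <= w e < theta)%R]|
      + (if (xi < 0)%R then mu B - #|opt S B| else 0)
    <= #|[set j in X | (xi < w j < theta)%R]| }.

(* theta is the least weight of a survivor of R(B), all of which outweigh i. *)
Lemma Binv_fails S C B r X i : Binv S C B r X -> ~~ can_kick w i r -> i \notin S ->
  exists theta, fails S C i B X theta.
Proof.
move=> [ru rsub rd XC XB low cnt]; rewrite negb_or => /andP[/hasPn nr d0] iS.
have {}d0 : r.2 = 0 by apply/eqP; rewrite -leqn0 leqNgt.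
have gt_i v : v \in r.1 -> (w i < w v)%R.
  move=> vr; rewrite lt_neqAle leNgt nr // andbT.
  apply: contraNneq iS => /w_inj ->.
  by have [_ /subsetP /(_ v (rsub _ vr))] := is_optP (optP S B); rewrite inE => /andP[].
have [theta [Hth ti mint]] : exists theta, [/\
    (exists2 v, v \in r.1 & w v = theta) \/ (forall y, (w y < theta)%R),
    (w i < theta)%R & forall v, v \in r.1 -> (theta <= w v)%R].
  case Er: r.1 => [|v0 l].
    have up y : (w y < 1 + \sum_x w x)%R.
      rewrite (bigD1 y) //=; have : (0 <= \sum_(x | x != y) w x)%R by apply: sumr_ge0.
      by lra.
    by exists (1 + \sum_x w x)%R; split=> //; right.
  have v0r : v0 \in r.1 by rewrite Er mem_head.
  case: (@Order.TotalTheory.arg_minP _ _ _ v0 (fun x => x \in r.1) w v0r) => v vr minv.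
  by rewrite -Er; exists (w v); split; [left; exists v|exact: gt_i|].
exists theta; split=> //; try exact/subsetP.
move=> xi; have := cnt theta xi Hth; rewrite d0 subn0; congr (_ + _ <= _).
apply: eq_card => e; rewrite !inE; case: (e \in opt S B) => //=.
case: (boolP (e \in r.1)) => //= er.
by rewrite [(_ < theta)%R]ltNge mint // andbF.
Qed.

Lemma Ginv_init S : Ginv S set0 (init mu opt S).
Proof. by move=> B _; apply: Binv_init. Qed.

Lemma order_uniq (sigma : {perm U}) : uniq (Defs.order sigma).
Proof. by rewrite map_inj_uniq ?enum_uniq //; apply: perm_inj. Qed.

(** Acceptance is final because SOL only grows; a refusal is read off the state just before [i]. *)
Lemma SOL_or_fails (sigma : {perm U}) t i (ord := Defs.order sigma) : t <= index i ord ->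
  i \in SOL w F mu opt sigma t \/
  exists B X theta, [/\ B \in F, i \in B
    & fails [set x | index x ord < t] [set x | t <= index x ord < index i ord]
        i B X theta].
Proof.
move=> ti; have uo : uniq ord := order_uniq sigma.
have memo x : x \in ord.
  by rewrite -[x](permKV sigma) map_f // mem_enum.
have ES : [set x | index x ord < t] = [set x in take t ord].
  by apply/setP => x; rewrite !inE in_take.
set S := [set x in take t ord] in ES.
have id : i \in drop t ord.
  have := memo i; rewrite -{1}(cat_take_drop t ord) mem_cat in_take //.
  by rewrite ltnNge ti.
have Sdrop x : x \in drop t ord -> x \notin S.
  move=> xd; rewrite inE; apply/negP => xt; move: uo.
  rewrite -(cat_take_drop t ord) cat_uniq => /and3P[_ /hasP[]].
  by exists x.
have [l1 [l2 Ed]] : exists l1 l2, drop t ord = l1 ++ i :: l2.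
  by case/splitPr: id => l1 l2; exists l1, l2.
have ud := drop_uniq t uo; rewrite -/ord Ed in ud.
move: (ud); rewrite cat_uniq /= => /and3P[ul1 hl /andP[il2 ul2]].
have il1 : i \notin l1 by apply: contra hl => ->.
have S0 : S \subset ~: set0 by rewrite setC0 subsetT.
have [|inv1 _] := run_inv (@Ginv_init S) ul1 S0.
  by move=> x xl; rewrite in_set0 andbT Sdrop // Ed mem_cat xl.
rewrite setU0 in inv1.
have SC1 : S \subset ~: [set x in l1].
  apply/subsetP => x; rewrite in_setC inE; apply: contraL => xl.
  by apply: Sdrop; rewrite Ed mem_cat xl.
have iS := Sdrop _ id.
have iC : i \notin [set x in l1] by rewrite inE.
have [inv2 _ dich] := process_inv SC1 inv1 iS iC.
case: dich => [iSOL|[B [BF iB nk]]]; [left|right].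
  rewrite /SOL -/S -/ord Ed foldl_cat /=.
  have [||_ sub] := run_inv inv2 ul2; last exact: (subsetP (sub _) _ iSOL).
    apply/subsetP => x xS; rewrite in_setC in_setU1 negb_or.
    rewrite (contraNneq _ iS) => [|<- //]; rewrite -in_setC /=.
    exact: (subsetP SC1).
  move=> x xl; have xd : x \in drop t ord by rewrite Ed mem_cat inE xl !orbT.
  rewrite Sdrop //= in_setU1 inE negb_or.
  rewrite (contraNneq _ il2) => [|<- //].
  apply: contra hl => xl1; apply/orP; right; apply/hasP; by exists x.
have [theta [XC XB low ti' cnt]] := Binv_fails (inv1 _ BF) nk iS.
exists B, (SOLst (run (init mu opt S) l1) B), theta; split=> //; rewrite ES; split=> //.
apply: subset_trans XC _; apply/subsetP => x; rewrite !inE => xl1.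
have xt : (x \in take t ord) = false.
  by have := @Sdrop x; rewrite Ed mem_cat xl1 => /(_ isT); rewrite inE => /negbTE.
have it : (i \in take t ord) = false by move: iS; rewrite inE => /negbTE.
rewrite -(cat_take_drop t ord) Ed !index_cat xt it xl1 (negbTE il1) /= eqxx addn0.
have st : t <= size ord by apply: leq_trans ti (index_size _ _).
by rewrite size_takel // leq_addr ltn_add2l index_mem.
Qed.

End Run.

(** * Rejection forces a walk to succeed *)

Section Walk.
Variables (U : finType) (w : U -> R) (F : {set {set U}}) (mu : {set U} -> nat).
Variable opt : {set U} -> {set U} -> {set U}.
Hypothesis lamF : laminar F.
Hypothesis w_ge0 : forall x, (0 <= w x)%R.
Hypothesis w_inj : injective w.
Hypothesis mu_mono : forall A B, A \in F -> B \in F -> A \proper B -> mu A < mu B.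
Hypothesis optP : forall V B, is_opt w F mu V B (opt V B).
Implicit Types (S C X Y A B V O I : {set U}) (x y i j : U).
Local Notation indep := (indep F mu).

(** [Some true] marks sampled elements and [Some false] early elements of T; [I] is the greedy
    sampled set and [d] the surplus of early over sampled among elements that can extend [I]. A
    sampled element met at [d = 0] is fatal once [I] has [r] elements; before that the truncation in
    [d.-1] holds the surplus at 0. *)
Fixpoint walk (m r : nat) (f : U -> option bool) (l : seq U) I (d : nat) : bool :=
  if l is x :: l' then
    if indep (x |: I) then
      match f x with
      | Some true => ((0 < d) || (#|I| < r)) && walk m r f l' (x |: I) d.-1
      | Some false => walk m r f l' I d.+1
      | None => walk m r f l' I d
      end
    else walk m r f l' I d
  else m - #|I| <= d.

Lemma eq_walk m r f g l I d : {in l, f =1 g} -> walk m r f l I d = walk m r g l I d.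
Proof.
elim: l I d => //= x l IH I d E; rewrite E ?mem_head //.
by rewrite !IH // => y yl; apply: E; rewrite inE yl orbT.
Qed.

(** Inside [B], the low rank of [j] means that heavier sampled elements leave a place for it in
    every [A]. A member above [B] meets [I] in no more than [B] does and has at least the capacity
    of [B]. *)
Lemma fails_indep S C i B X theta I j : fails w F mu opt S C i B X theta ->
  B \in F -> j \in X -> indep I -> I \subset S -> I \subset B ->
  (forall e, e \in I -> (w j < w e)%R) -> indep (j |: I).
Proof.
move=> [XC /subsetP XB low _ _] BF jX iI IS IB gtj.
have jB := XB _ jX.
have bound A : A \in F -> j \in A -> A \subset B -> #|I :&: A| < mu A.
  move=> AF jA AB; apply: leq_ltn_trans (low _ _ jX AF jA AB).
  apply: (opt_card_max lamF w_inj (optP S A)) => //.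
  - by apply: indepS iI; apply: subsetIl.
  - by apply: setSI.
  - by move=> y; rewrite inE => /andP[/gtj].
apply: indep_setU1 => // A AF jA; case/or3P: (lamF AF BF) => [AB|BA|].
- exact: bound.
- have -> : I :&: A = I :&: B.
    by rewrite (setIidPl (subset_trans IB BA)) (setIidPl IB).
  have lt := bound _ BF jB (subxx _).
  apply: leq_trans lt _; case: (eqVneq B A) => [-> //|nBA].
  by apply/ltnW/mu_mono => //; rewrite properEneq nBA.
by move/pred0P => /(_ j); rewrite /= jA jB.
Qed.

Lemma window_lt (xi theta : R) X : (forall x, x \in X -> (xi < w x)%R) ->
  [set x in X | (xi < w x < theta)%R] = [set x in X | (w x < theta)%R].
Proof.
move=> H; apply/setP => x; rewrite !inE; case: (boolP (x \in X)) => //= /H ->.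
by [].
Qed.

(** Induction along [l], heaviest first. Elements of [O] already read are in [I], and below [theta]
    the part of [X] already read exceeds [I] by at most [d]. Every element of [X] or [O] can extend
    [I] when it is read, so none is skipped. The windows of [fails_count] then exclude the fatal
    step and give the final inequality. *)
Lemma fails_walk (f : U -> option bool) i B X theta r l :
  fails w F mu opt [set x | f x == Some true] [set x | f x == Some false] i B X theta ->
  B \in F -> f i = None ->
  (forall Y, indep Y -> Y \subset B -> (forall y, y \in Y -> (w i < w y)%R) ->
     #|Y| <= r) ->
  pairwise (fun x y => (w y < w x)%R) l -> l =i B :\ i ->
  walk (mu B) r f l set0 0.
Proof.
move=> fail BF fi rank.
set S := [set x | f x == Some true] in fail.
set C := [set x | f x == Some false] in fail.
have [/subsetP XC /subsetP XB low ti cnt] := fail.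
set O := opt S B in cnt.
have optO : is_opt w F mu S B O := optP S B.
have [iO OSB maxO] := is_optP optO.
have OS x : x \in O -> x \in S by move/(subsetP OSB); rewrite inE => /andP[].
have OB x : x \in O -> x \in B by move/(subsetP OSB); rewrite inE => /andP[].
have th0 : (0 < theta)%R by apply: le_lt_trans ti.
have iX : i \notin X by apply/negP => /XC; rewrite inE fi.
have iNO : i \notin O by apply/negP => /OS; rewrite inE fi.
move=> srt El.
have lB : {subset l <= B} by move=> x; rewrite El !inE => /andP[].
have il : i \notin l by rewrite El !inE eqxx.
have H1 : forall e, e \in O -> e \notin l -> e \in (set0 : {set U}).
  move=> e eO; rewrite El !inE OB // andbT negbK => /eqP E.
  by rewrite -E eO in iNO.
have H2 : forall j x, j \in X -> j \notin l -> x \in l -> (w x < w j)%R.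
  move=> j x jX; rewrite El !inE XB // andbT negbK => /eqP E.
  by rewrite -E jX in iX.
have H3 : #|[set j in X | (j \notin l) && (w j < theta)%R]| <=
    0 + #|[set e in set0 : {set U} | (w e < theta)%R]|.
  rewrite leq_eqVlt; apply/orP; left; apply/eqP; rewrite add0n.
  apply: eq_card => x; rewrite !inE /=; case: (boolP (x \in X)) => //= xX.
  rewrite El !inE XB // andbT negbK; case: eqP => //= E.
  by rewrite -E xX in iX.
have IS : set0 \subset S by apply: sub0set.
have IB : set0 \subset B by apply: sub0set.
have iI : indep set0 by apply: indepS (sub0set O) iO.
have Ilt : forall e x, e \in (set0 : {set U}) -> x \in l -> (w x < w e)%R.
  by move=> e x; rewrite inE.
have IO : forall e, e \in (set0 : {set U}) -> (0 < w e)%R -> e \in O.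
  by move=> e; rewrite inE.
move: (set0 : {set U}) 0 IS IB iI Ilt IO H1 H2 H3 => I d.
clear El; elim: l I d srt lB il => [|x l IH] I d /=.
  move=> _ _ _ IS IB iI Ilt IO OI _ cntX.
  (* A window opening below 0 takes in all of [O] under [theta] and charges the dummies as well,
     whence [mu B - #|I| <= d]. *)
  have := cnt (-1)%R; rewrite ltrN10.
  have -> : [set e in O | (-1 <= w e < theta)%R] = [set e in O | (w e < theta)%R].
    by apply/setP => x; rewrite !inE (le_trans _ (w_ge0 x)) // lerN10.
  rewrite (@window_lt (-1)%R theta X); last first.
    by move=> x _; apply: lt_le_trans (w_ge0 x); apply: ltrN10.
  have {}cntX : #|[set j in X | (w j < theta)%R]| <= d + #|[set e in I | (w e < theta)%R]|.
    exact: cntX.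
  have split (Z : {set U}) : #|Z| = #|[set e in Z | (w e < theta)%R]| +
                        #|[set e in Z | ~~ (w e < theta)%R]|.
    by rewrite -(cardsID [set e | (w e < theta)%R] Z); congr (_ + _);
      apply: eq_card => x; rewrite !inE // andbC.
  have sub : #|[set e in O | ~~ (w e < theta)%R]| <= #|[set e in I | ~~ (w e < theta)%R]|.
    apply: subset_leq_card; apply/subsetP => e; rewrite !inE => /andP[eO ->].
    by rewrite OI.
  have ar (m o n o1 o2 n1 n2 a : nat) : o = o1 + o2 -> n = n1 + n2 -> o2 <= n2 ->
    a <= d + n1 -> o1 + (m - o) <= a -> m - n <= d by clear; lia.
  exact: ar (split O) (split I) sub cntX.
move=> /andP[/allP xl srt] lB; rewrite inE negb_or => /andP[ix il] IS IB iI Ilt IO OI HX cntX.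
have xB : x \in B by apply: lB; rewrite mem_head.
have xlN : x \notin l by apply/negP => /xl; rewrite ltxx.
have lB' : {subset l <= B} by move=> y yl; apply: lB; rewrite inE yl orbT.
have HXl : forall j y, j \in X -> j \notin l -> y \in l -> (w y < w j)%R.
  move=> j y jX jl yl; case: (eqVneq j x) => [->|nx]; first exact: xl.
  by apply: HX; rewrite ?inE ?yl ?orbT // negb_or nx.
have Iltl : forall e y, e \in I -> y \in l -> (w y < w e)%R.
  by move=> e y eI yl; apply: Ilt => //; rewrite inE yl orbT.
have Ix e : e \in I -> (w x < w e)%R by move=> eI; apply: Ilt (mem_head _ _).
have Iw0 e : e \in I -> e \in O by move=> eI; apply: IO => //; apply: le_lt_trans (Ix _ eI).
have xI : x \notin I by apply/negP => /Ix; rewrite ltxx.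
have sameX : x \notin X -> [set j in X | (j \notin l) && (w j < theta)%R] =
    [set j in X | (j \notin x :: l) && (w j < theta)%R].
  move=> xX; apply/setP => j; rewrite !inE negb_or; case: eqVneq => // ->.
  by rewrite (negbTE xX).
have OIl : x \notin O -> forall e, e \in O -> e \notin l -> e \in I.
  move=> xO e eO el; apply: OI => //; rewrite inE negb_or el andbT.
  by apply: contraNneq xO => <-.
case: ifPn => [ixI|nixI]; last first.
  have xO : x \notin O.
    apply: contra nixI => xO; apply: indepS iO; apply/subsetP => e.
    by rewrite !inE => /predU1P[->|/Iw0].
  have xX : x \notin X.
    by apply: contra nixI => xX; apply: fails_indep fail BF xX iI IS IB Ix.
  by apply: IH => //; rewrite ?sameX //; apply: OIl.
case fx: (f x) => [[]|].
- have xS : x \in S by rewrite inE fx.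
  have xX : x \notin X by apply/negP => /XC; rewrite inE fx.
  have IxS : x |: I \subset S by rewrite subUset sub1set xS.
  have IxB : x |: I \subset B by rewrite subUset sub1set xB.
  have xO : (0 < w x)%R -> x \in O.
    move=> wx; apply: (opt_greedy lamF w_inj optO) => //.
    apply: indepS ixI; apply: setUS; apply/subsetP => e; rewrite inE => /andP[eO lt].
    apply: OI => //; rewrite inE negb_or; apply/andP; split.
      by apply: contraTneq lt => ->; rewrite ltxx.
    by apply/negP => /xl /(lt_trans lt); rewrite ltxx.
  apply/andP; split.
    case: (ltnP #|I| r) => [|rI]; rewrite ?orbT // orbF lt0n; apply/negP => /eqP d0.
    (* [x |: I] has more than [r] elements, so not all of them outweigh [i]; being below [i], [x] is
       also below [theta]. The window opening at [w x] then holds one more element of [O] than the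
       bound on [X] permits. *)
    have xi : (w x < w i)%R.
      rewrite ltNge; apply/negP => le.
      have : #|x |: I| <= r.
        apply: rank => // y; rewrite !inE => /predU1P[->|/Ix]; last exact: le_lt_trans.
        by rewrite lt_neqAle le andbT; apply: contraNneq ix => /w_inj ->.
      by rewrite cardsU1 xI leqNgt ltnS rI.
    rewrite d0 add0n -sameX // in cntX.
    case: (boolP (x \in O)) => [xO'|xNO].
      have := cnt (w x); rewrite ltNge w_ge0 /= addn0.
      have : #|[set j in X | (w x < w j < theta)%R]| <=
             #|[set j in X | (j \notin l) && (w j < theta)%R]|.
        apply: subset_leq_card; apply/subsetP => j; rewrite !inE => /and3P[jX lt ->].
        rewrite jX andbT /=; apply/negP => /xl /(lt_trans lt); by rewrite ltxx.
      have : #|x |: [set e in I | (w e < theta)%R]| <= #|[set e in O | (w x <= w e < theta)%R]|.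
        apply: subset_leq_card; apply/subsetP => e; rewrite !inE.
        case/predU1P => [->|/andP[eI ->]]; first by rewrite xO' lexx (lt_trans xi ti).
        by rewrite Iw0 // ltW // Ix.
      rewrite cardsU1 inE (negbTE xI) /= add1n => h1 h2 h3.
      by have := leq_trans h1 (leq_trans h3 (leq_trans h2 cntX)); rewrite ltnn.
    (* Only a weightless [x] can be missing from [O]. Then all of [O] and [X] has been read, and the
       dummies supply the contradiction because [I] still has room for [x]. *)
    have wx0 : w x = 0%R.
      apply/eqP; rewrite eq_le w_ge0 andbT leNgt; apply: contra xNO; exact: xO.
    have Xl j : j \in X -> j \notin l.
      by move=> jX; apply/negP => /xl; rewrite wx0 ltNge w_ge0.
    have := cnt (-1)%R; rewrite ltrN10 (@window_lt (-1)%R theta X); last first.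
      by move=> y _; apply: lt_le_trans (w_ge0 y); apply: ltrN10.
    have EX : [set j in X | (j \notin l) && (w j < theta)%R] =
            [set j in X | (w j < theta)%R].
      by apply/setP => j; rewrite !inE; case: (boolP (j \in X)) => // /Xl ->.
    rewrite EX in cntX.
    have : #|[set e in I | (w e < theta)%R]| <= #|[set e in O | (-1 <= w e < theta)%R]|.
      apply: subset_leq_card; apply/subsetP => e; rewrite !inE => /andP[/Iw0 -> ->].
      by rewrite (le_trans _ (w_ge0 e)) // lerN10.
    have : #|O| <= #|I|.
      apply: subset_leq_card; apply/subsetP => e eO; apply: OIl => //.
      by apply/negP => /xl; rewrite wx0 ltNge w_ge0.
    have : #|I| < mu B.
      have := indepP _ _ _ ixI _ BF; rewrite (setIidPl IxB) cardsU1 xI //.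
    have ar (a b c o n m : nat) :
      a <= b -> n < m -> o <= n -> b <= c -> c + (m - o) <= a -> False by clear; lia.
    by move: cntX; apply: ar.
  apply: IH => //.
  - by move=> e y; rewrite !inE => /predU1P[->|eI] yl; [exact: xl|exact: Iltl].
  - by move=> e; rewrite !inE => /predU1P[->|eI] // _; apply: Iw0.
  - move=> e eO el; rewrite !inE; case: eqVneq => //= ex; apply: OI => //.
    by rewrite inE negb_or ex.
  case: (ltP (w x) theta) => wt.
    have -> : [set e in x |: I | (w e < theta)%R] = x |: [set e in I | (w e < theta)%R].
      by apply/setP => e; rewrite !inE; case: eqVneq => //= ->.
    rewrite sameX // cardsU1 inE (negbTE xI) /=; apply: leq_trans cntX _.
    by rewrite addnCA addnA leq_add2r; case: (d).
  (* If [x] weighs at least [theta], every element of [X] read so far is heavier still, so the count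
     is zero. *)
  rewrite eq_card0 // => j; rewrite !inE; apply/negP => /and3P[jX jl jt].
  have jx : j != x by apply: contraNneq xX => <-.
  have : (w x < w j)%R by apply: HX; rewrite ?mem_head // inE negb_or jx.
  by move/(le_lt_trans wt)/(lt_trans jt); rewrite ltxx.
- have xO : x \notin O by apply/negP => /OS; rewrite inE fx.
  apply: IH => //; first exact: OIl.
  have : #|[set j in X | (j \notin l) && (w j < theta)%R]| <=
      #|x |: [set j in X | (j \notin x :: l) && (w j < theta)%R]|.
    apply: subset_leq_card; apply/subsetP => j; rewrite !inE negb_or.
    by case: eqVneq.
  move/leq_trans; apply; rewrite cardsU1 addSn -add1n; apply: leq_add cntX.
  by case: (_ \notin _).
have xO : x \notin O by apply/negP => /OS; rewrite inE fx.
have xX : x \notin X by apply/negP => /XC; rewrite inE fx.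
by apply: IH => //; rewrite ?sameX //; apply: OIl.
Qed.

End Walk.

(** * Independent random colours *)

Section ColourMeasure.
Local Open Scope ring_scope.
Variables (K : realFieldType) (U : finType) (a b c : K).
Hypotheses (a_ge0 : 0 <= a) (b_ge0 : 0 <= b) (c_ge0 : 0 <= c) (abc1 : a + b + c = 1).
Local Notation coloring := {ffun U -> option bool}.

Definition wt (o : option bool) : K :=
  match o with Some true => a | Some false => b | None => c end.

Lemma big_option_bool (g : option bool -> K) :
  \sum_o g o = g (Some true) + g (Some false) + g None.
Proof.
rewrite (bigD1 (Some true)) //= (bigD1 (Some false)) //= (bigD1 None) //=.
by rewrite big1 ?addr0 ?addrA // => -[[]|].
Qed.

Definition Ecol (g : coloring -> K) : K :=
  \sum_(f : coloring) (\prod_x wt (f x)) * g f.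

Definition indep_at (x : U) (g : coloring -> K) :=
  forall f f' : coloring, (forall y, y != x -> f y = f' y) -> g f = g f'.

(** Integrates out all colours but that of [x], whose factor is omitted. If [g] ignores [x], this is
    [Ecol g] for every [o]. *)
Definition Zcol (x : U) (o : option bool) (g : coloring -> K) :=
  \sum_(f : coloring | f x == o) (\prod_(y | y != x) wt (f y)) * g f.

Lemma Zcol_const x o o' g : indep_at x g -> Zcol x o g = Zcol x o' g.
Proof.
move=> ig; pose setx (o : option bool) (f : coloring) : coloring :=
  [ffun y => if y == x then o else f y].
rewrite /Zcol (reindex_onto (setx o) (setx o')) /=; last first.
  move=> f /eqP fx; apply/ffunP => y; rewrite !ffunE; case: eqP => // ->.
  by rewrite fx.
apply: eq_big => [f|f _].
  rewrite ffunE eqxx eqxx /=; apply/eqP/eqP => [<-|fx].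
    by rewrite ffunE eqxx.
  by apply/ffunP => y; rewrite !ffunE; case: eqP => // ->.
congr (_ * _); last by apply: ig => y ny; rewrite ffunE (negbTE ny).
by apply: eq_bigr => y ny; rewrite ffunE (negbTE ny).
Qed.

Lemma Ecol_split x (h : option bool -> coloring -> K) :
  Ecol (fun f => h (f x) f) = \sum_o wt o * Zcol x o (h o).
Proof.
rewrite /Ecol (partition_big (fun f : coloring => f x) predT) //=.
apply: eq_bigr => o _; rewrite /Zcol mulr_sumr; apply: eq_bigr => f /eqP fx.
by rewrite (bigD1 x) //= fx mulrA.
Qed.

Lemma Ecol_Zcol x o g : indep_at x g -> Ecol g = Zcol x o g.
Proof.
move=> ig; rewrite (Ecol_split x (fun _ => g)) big_option_bool.
by rewrite !(Zcol_const _ o ig) -!mulrDl /= abc1 mul1r.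
Qed.

Lemma Ecol_cond x (h : option bool -> coloring -> K) :
  (forall o, indep_at x (h o)) ->
  Ecol (fun f => h (f x) f) = \sum_o wt o * Ecol (h o).
Proof.
move=> ih; rewrite Ecol_split; apply: eq_bigr => o _.
by rewrite (Ecol_Zcol o (ih o)).
Qed.

Lemma Ecol_cst k : Ecol (fun=> k) = k.
Proof.
rewrite /Ecol -mulr_suml -(bigA_distr_bigA (fun _ => wt)) /=.
by rewrite big1 ?mul1r // => x _; rewrite big_option_bool.
Qed.

End ColourMeasure.

(** * Supersolutions bound the walk *)

Section WalkBound.
Local Open Scope ring_scope.
Variables (K : realFieldType) (U : finType) (a b c : K).
Hypotheses (a_ge0 : 0 <= a) (b_ge0 : 0 <= b) (c_ge0 : 0 <= c) (abc1 : a + b + c = 1).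
Variables (F : {set {set U}}) (mu : {set U} -> nat).

(** [H u d] is to dominate the probability that the walk succeeds with remaining capacity [u] and
    surplus [d]. Late elements do not move the walk, so [c] cancels. For [m = s + 1 + r], the lethal
    condition [u <= s] on the capacity left after the step is [r <= #|I|] before it. *)
Record supersol (s : nat) (H : nat -> nat -> K) : Prop := Supersol {
  supersol_ge0 : forall u d, 0 <= H u d;
  supersol_end : forall u d, (u <= d)%N -> 1 <= H u d;
  supersol_step : forall u d,
    a * (if (d == 0)%N && (u <= s)%N then 0 else H u d.-1) + b * H u.+1 d.+1
    <= (a + b) * H u.+1 d }.

(** Condition on the colour of the next element. An element that cannot extend [I] leaves the state
    unchanged, so the bound does not depend on which elements get counted. *)
Lemma Ecol_walk (s m r : nat) H (B : {set U}) l (I : {set U}) d :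
  supersol s H -> m = (s.+1 + r)%N -> B \in F -> mu B = m ->
  uniq l -> {subset l <= B} -> I \subset B -> {in l, forall x, x \notin I} ->
  Ecol a b c (fun f => (walk F mu m r f l I d)%:R) <= H (m - #|I|)%N d.
Proof.
move=> [H0 Hend Hstep] mE BF muB.
elim: l I d => [|x l IH] I d.
  move=> _ _ _ _ /=; rewrite Ecol_cst //.
  by case: (leqP (m - #|I|)%N d) => [/Hend|_]; rewrite ?H0.
move=> /= /andP[xl ul] lB IB lI.
have lB' : {subset l <= B} by move=> y yl; apply: lB; rewrite inE yl orbT.
have xI : x \notin I by apply: lI; rewrite mem_head.
have lI' : {in l, forall x, x \notin I} by move=> y yl; apply: lI; rewrite inE yl orbT.
case ixI: (indep F mu (x |: I)); last exact: IH.
have xB : x \in B by apply: lB; rewrite mem_head.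
have IxB : x |: I \subset B by rewrite subUset sub1set xB.
have lIx : {in l, forall y, y \notin x |: I}.
  by move=> y yl; rewrite !inE negb_or lI' // andbT; apply: contraNneq xl => <-.
have cI : (#|I| < m)%N.
  by have := indepP _ _ _ ixI _ BF; rewrite (setIidPl IxB) cardsU1 xI muB.
pose h o (f : {ffun U -> option bool}) : K := match o with
  | Some true => (((0 < d) || (#|I| < r))%N && walk F mu m r f l (x |: I) d.-1)%:R
  | Some false => (walk F mu m r f l I d.+1)%:R
  | None => (walk F mu m r f l I d)%:R
  end.
have ih o : indep_at x (h o).
  move=> f f' E; have E' : {in l, f =1 f'}.
    by move=> y yl; apply: E; apply: contraNneq xl => <-.
  by case: o => [[]|]; rewrite /h (eq_walk _ _ _ _ _ _ E').
rewrite (_ : Ecol a b c _ = Ecol a b c (fun f => h (f x) f)); last first.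
  by apply: eq_bigr => f _; congr (_ * _); rewrite /h; case: (f x) => [[]|].
rewrite Ecol_cond // big_option_bool /=.
have [u Eu] : exists u, (m - #|I|)%N = u.+1 by exists (m - #|I|).-1; move: cI; clear; lia.
have Eu' : (m - #|x |: I|)%N = u by rewrite cardsU1 xI; move: Eu; clear; lia.
have := Hstep u d; rewrite Eu.
have b1 : Ecol a b c (h (Some false)) <= H u.+1 d.+1 by rewrite -Eu; exact: IH.
have b2 : Ecol a b c (h None) <= H u.+1 d by rewrite -Eu; exact: IH.
have b3 : Ecol a b c (h (Some true)) <=
    (if (d == 0)%N && (u <= s)%N then 0 else H u d.-1).
  have -> : (d == 0)%N && (u <= s)%N = ~~ ((0 < d) || (#|I| < r))%N.
    by move: Eu mE cI; clear; lia.
  rewrite /h; case: (_ || _) => /=; last by rewrite Ecol_cst.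
  by rewrite -Eu'; apply: IH.
have := ler_wpM2l a_ge0 b3; have := ler_wpM2l b_ge0 b1; have := ler_wpM2l c_ge0 b2.
have Hc : H u.+1 d = (a + b) * H u.+1 d + c * H u.+1 d by rewrite -mulrDl abc1 mul1r.
rewrite [X in _ -> _ -> _ -> _ -> _ <= X]Hc.
by lra.
Qed.

End WalkBound.

(** * Explicit supersolutions *)

Section SuperSolution.
Local Open Scope ring_scope.
Variables (K : realFieldType) (q z r : K).
Hypotheses (q_gt0 : 0 < q) (q_lt : 2 * q < 1).
Hypotheses (zE : 2 * q * z = 1) (rE : r = 4 * q * (1 - q)).

(** [r^j z^d] solves the recursion exactly away from [d = 0], and [z = 1/(2q)] makes [r] smallest
    among such solutions. The second term grows by [r^j (1 - 2q)] per step, exactly what the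
    truncation at [d = 0] costs. *)
Definition Phi (j d : nat) : K := r ^+ j * z ^+ d + (1 - r ^+ j) / (1 - 2 * q).

Lemma z_ge1 : 1 <= z.
Proof. by have := q_gt0; have := q_lt; have := zE; nra. Qed.

Lemma r_ge0 : 0 <= r.
Proof. by have := q_gt0; have := q_lt; rewrite rE; nra. Qed.

Lemma r_le1 : r <= 1.
Proof. by have := sqr_ge0 (1 - 2 * q); rewrite rE; nra. Qed.

Lemma rzE : r * z = 2 * (1 - q).
Proof.
rewrite rE; have -> : 4 * q * (1 - q) * z = 2 * q * z * (2 * (1 - q)) by ring.
by rewrite zE mul1r.
Qed.

Lemma z_step d : (1 - q) * z ^+ d + q * (r * z ^+ d.+2) = r * z ^+ d.+1.
Proof.
have E : z ^+ d.+1 = z * z ^+ d by rewrite exprS.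
have -> : r * z ^+ d.+1 = (2 * q * z) * (r * z) * z ^+ d.
  by rewrite zE mul1r E; ring.
have -> : q * (r * z ^+ d.+2) = q * z * (r * z) * z ^+ d by rewrite !exprS; ring.
have zE' := zE; rewrite rzE.
have -> : q * z = 2^-1 by lra.
have -> : 2 * q * z = 1 by [].
by field.
Qed.

Lemma Phi_step j d : (1 - q) * Phi j d.-1 + q * Phi j.+1 d.+1 <= Phi j.+1 d.
Proof.
have hq := q_gt0; have hq' := q_lt.
have t0 : 0 <= r ^+ j by apply: exprn_ge0 r_ge0.
have E : (1 - r ^+ j.+1) / (1 - 2 * q) =
    (1 - r ^+ j) / (1 - 2 * q) + r ^+ j * (1 - 2 * q).
  by rewrite exprS rE; field; lra.
rewrite /Phi E; move: (_ / (1 - 2 * q)) => k.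
have := z_step; have := zE; have := rzE.
rewrite [r ^+ j.+1]exprS; move: (r ^+ j) t0 => t t0 rz z1 zs.
case: d => [|d] /=.
  rewrite expr0 expr1; have -> : q * (r * t * z + (k + t * (1 - 2 * q))) =
    q * (r * z) * t + q * (k + t * (1 - 2 * q)) by ring.
  by rewrite rz rE le_eqVlt; apply/orP; left; apply/eqP; ring.
have -> : (1 - q) * (t * z ^+ d + k) + q * (r * t * z ^+ d.+2 + (k + t * (1 - 2 * q)))
   = t * ((1 - q) * z ^+ d + q * (r * z ^+ d.+2)) + k + q * (t * (1 - 2 * q)) by ring.
rewrite zs; have : 0 <= (1 - q) * (t * (1 - 2 * q)).
  by apply: mulr_ge0; [lra|apply: mulr_ge0 => //; lra].
lra.
Qed.

(** Here [r^j z^d] is at least [(r z)^j z^e], and [r z = 2(1-q)] is at least 1. *)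
Lemma Phi_ge e j d : (e + j <= d)%N -> z ^+ e <= Phi j d.
Proof.
move=> le; have hq := q_gt0; have hq' := q_lt.
have k0 : 0 <= (1 - r ^+ j) / (1 - 2 * q).
  apply: divr_ge0; last by lra.
  by rewrite subr_ge0; apply: exprn_ile1 r_ge0 r_le1.
rewrite -[X in X <= _]addr0 /Phi lerD // -(subnKC le) !exprD.
have z1 n : 1 <= z ^+ n by apply: exprn_ege1; apply: z_ge1.
set y := z ^+ (d - _); have -> : r ^+ j * (z ^+ e * z ^+ j * y) =
  z ^+ e * (r ^+ j * z ^+ j * y) by ring.
rewrite ler_peMr ?(le_trans ler01) // mulr_ege1 ?z1 //.
by rewrite -exprMn rzE exprn_ege1 //; lra.
Qed.

Lemma Phi0_le j : Phi j 0 <= (1 - 2 * q)^-1.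
Proof.
have hq := q_gt0; have hq' := q_lt.
rewrite /Phi expr0 mulr1.
have : 1 <= (1 - 2 * q)^-1 by rewrite invf_ge1; lra.
move/(ler_wpM2l (exprn_ge0 j r_ge0)); lra.
Qed.

Lemma Phi_ge1 j d : 1 <= Phi j d.
Proof.
have hq := q_gt0; have hq' := q_lt.
have t0 := exprn_ge0 j r_ge0; have t1 := exprn_ile1 j r_ge0 r_le1.
have : 1 - r ^+ j <= (1 - r ^+ j) / (1 - 2 * q).
  by rewrite ler_peMr ?subr_ge0 // invf_ge1; lra.
have : r ^+ j <= r ^+ j * z ^+ d by rewrite ler_peMr // exprn_ege1 // z_ge1.
rewrite /Phi; lra.
Qed.

(* The affine shape a + b Phi interpolates the exact value q, 1, 1, ... one step before the end. *)
Lemma supersol0 : exists2 H, supersol (1 - q) q 0 H &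
  forall m, (0 < m)%N -> H m 0 <= q / (1 - 2 * q) ^+ 2.
Proof.
have hq := q_gt0; have hq' := q_lt.
pose a0 := - q / (1 - 2 * q); pose b0 := 2 * q * (1 - q) / (1 - 2 * q).
have ab : a0 + b0 = q by rewrite /a0 /b0; field; lra.
have b0_ge0 : 0 <= b0.
  by rewrite /b0; apply: divr_ge0; [rewrite !mulr_ge0 //; lra|lra].
have abz : a0 + b0 * z = 1.
  have -> : b0 * z = (2 * q * z) * (1 - q) / (1 - 2 * q) by rewrite /b0; ring.
  by rewrite zE /a0; field; lra.
pose H u d : K := match u with
  | 0 => 1 | 1 => if d == 0%N then q else 1 | v.+2 => a0 + b0 * Phi v.+1 d end.
exists H.
  split=> [u d|u d|u d].
  - case: u => [|[|u]] /=; first by [].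
      by case: ifP => _; lra.
    by have := ler_wpM2l b0_ge0 (Phi_ge1 u.+1 d); lra.
  - case: u => [|[|u]] /= ud; first by [].
      by rewrite ifF //; apply/negbTE; rewrite -lt0n.
    have := @Phi_ge 1 u.+1 d; rewrite expr1 add1n => /(_ ud).
    by move/(ler_wpM2l b0_ge0); lra.
  - have -> : (1 - q + q) = 1 by ring.
    rewrite leqn0 mul1r; case: u => [|[|u]] /=.
    + by case: d => [|d] /=; lra.
    + rewrite andbF; have := ler_wpM2l b0_ge0 (Phi_step 0 d).
      suff : (1 - q) * (if d.-1 == 0%N then q else 1) <= (1 - q) * (a0 + b0 * Phi 0 d.-1).
        by lra.
      rewrite ler_wpM2l //; first by lra.
      case: (eqVneq d.-1 0%N) => [->|]; first by rewrite /Phi !expr0 subrr mul0r addr0 !mulr1 ab.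
      rewrite -lt0n => d1; have := @Phi_ge 1 0 d.-1; rewrite expr1 addn0 => /(_ d1).
      by move/(ler_wpM2l b0_ge0); lra.
    by rewrite andbF; have := ler_wpM2l b0_ge0 (Phi_step u.+1 d); lra.
have E : q / (1 - 2 * q) ^+ 2 = a0 + b0 * (1 - 2 * q)^-1.
  by rewrite /a0 /b0; field; lra.
case=> [|[|u]] //= _.
  rewrite ler_peMr ?invf_ge1 ?exprn_gt0 ?exprn_ile1 //; lra.
by rewrite E lerD2l ler_wpM2l // Phi0_le.
Qed.

(** With [u = v + 2]: for [v <= e] a step down at surplus 0 is lethal and the pure exponential
    [r^v z^d] suffices; beyond that [Phi] accounts for the truncation. The factor [4 q^2 = z^(-2)]
    normalises to 1 at [u = d = 2], and the values at [u = 2] are those of the exponential cut off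
    at 1. *)
Lemma supersolS e : exists2 H, supersol (1 - q) q e.+1 H &
  forall m, (e.+1 < m)%N -> H m 0 <= 4 * q ^+ 2 * r ^+ e / (1 - 2 * q).
Proof.
have hq := q_gt0; have hq' := q_lt.
pose G v d : K := 4 * q ^+ 2 * r ^+ (minn v e) * Phi (v - e) d.
have q2 : 0 <= 4 * q ^+ 2 by rewrite mulr_ge0 // exprn_ge0 ?ltW.
pose H u d : K := match u with
  | 0 => 1 | 1 => if d == 0%N then q else 1
  | 2 => if d == 0%N then 4 * q ^+ 2 else if d == 1%N then 2 * q else 1
  | v.+2 => G v d end.
have z2q : 4 * q ^+ 2 * z ^+ 2 = 1.
  have -> : 4 * q ^+ 2 * z ^+ 2 = (2 * q * z) ^+ 2 by ring.
  by rewrite zE expr1n.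
have G0 d : G 0%N d = 4 * q ^+ 2 * z ^+ d.
  by rewrite /G min0n sub0n /Phi !expr0 subrr mul0r addr0 mul1r mulr1.
have H2G d : H 2%N d <= G 0%N d.
  rewrite /H G0; case: d => [|[|d]] /=.
  - by rewrite expr0 mulr1.
  - have -> : 4 * q ^+ 2 * z ^+ 1 = 2 * q * z * (2 * q) by ring.
    by rewrite zE mul1r.
  - have -> : z ^+ d.+2 = z ^+ 2 * z ^+ d by rewrite -exprD.
    by rewrite mulrA z2q mul1r exprn_ege1 // z_ge1.
have G_step v d : (1 - q) * (if (d == 0)%N && (v.+2 <= e.+1)%N then 0 else G v d.-1)
    + q * G v.+1 d.+1 <= G v.+1 d.
  rewrite /G; case: (ltnP v e) => ve.
    rewrite ltnS ve andbT (minn_idPl ve).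
    rewrite (eqP (ve : (v.+1 - e == 0)%N)) (eqP (ltnW ve : (v - e == 0)%N)).
    have P0 k : Phi 0 k = z ^+ k by rewrite /Phi !expr0 subrr mul0r addr0 mul1r.
    rewrite !P0; have t0 : 0 <= 4 * q ^+ 2 * r ^+ v by rewrite mulr_ge0 // exprn_ge0 // r_ge0.
    rewrite [r ^+ v.+1]exprSr; case: d => [|d] /=.
      rewrite expr0 expr1.
      have -> : q * (4 * q ^+ 2 * (r ^+ v * r) * z) = q * z * (4 * q ^+ 2 * r ^+ v) * r by ring.
      have -> : q * z = 2^-1 by have := zE; lra.
      by have := mulr_ge0 t0 r_ge0; lra.
    by have := congr1 (fun x => 4 * q ^+ 2 * r ^+ v * x) (z_step d); lra.
  rewrite [(v.+2 <= _)%N]ltnS ltnNge ve andbF (minn_idPr (leqW ve)) subSn //.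
  have t0 : 0 <= 4 * q ^+ 2 * r ^+ e by rewrite mulr_ge0 // exprn_ge0 // r_ge0.
  by have := ler_wpM2l t0 (Phi_step (v - e) d); lra.
have G_ge0 v d : 0 <= G v d.
  rewrite /G; apply: mulr_ge0; last exact: le_trans ler01 (Phi_ge1 _ _).
  by rewrite mulr_ge0 // exprn_ge0 // r_ge0.
have G_end v d : (v.+2 <= d)%N -> 1 <= G v d.
  move=> vd; have le : (2 + minn v e + (v - e) <= d)%N by move: vd; clear; lia.
  have := Phi_ge le; rewrite exprD => h.
  have t0 : 0 <= 4 * q ^+ 2 * r ^+ (minn v e) by rewrite mulr_ge0 // exprn_ge0 // r_ge0.
  have := ler_wpM2l t0 h; apply: le_trans.
  have -> : 4 * q ^+ 2 * r ^+ minn v e * (z ^+ 2 * z ^+ minn v e) =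
     (4 * q ^+ 2 * z ^+ 2) * (r ^+ minn v e * z ^+ minn v e) by ring.
  by rewrite z2q mul1r -exprMn exprn_ege1 // rzE; lra.
have HG v d : H v.+2 d <= G v d by case: v => [|v].
exists H.
  split=> [u d|u d|u d].
  - case: u => [|[|[|u]]] //=; do ?[case: ifP => _]; rewrite ?q2 //; lra.
  - case: u => [|[|[|u]]] //= ud.
    + by rewrite ifF //; apply/negbTE; rewrite -lt0n.
    + by case: d ud => [|[|d]].
    exact: G_end.
  - have -> : (1 - q + q) = 1 by ring.
    rewrite mul1r; case: u => [|[|u]].
    + by case: d => [|d] /=; lra.
    + case: d => [|[|d]] /=.
      * by have := sqr_ge0 q; lra.
      * by have := sqr_ge0 q; lra.
      by lra.
    apply: le_trans (G_step u d); rewrite lerD2r ler_wpM2l //; first by lra.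
    by case: ifP => // _; apply: HG.
move=> [|[|v]] // ve; apply: le_trans (HG _ _) _.
rewrite /G (minn_idPr _) //; apply: ler_wpM2l; last exact: Phi0_le.
by rewrite mulr_ge0 // exprn_ge0 // r_ge0.
Qed.

End SuperSolution.

(** Writing c = 4p(1-p), one has 1 - c = (1-2p)^2, so c < 1/2 says 1-2p > 1/sqrt 2. This gives
    [(1-2q)^2 >= 1/2] for [s = 0]. For [s > 0] it gives [2(1-p)(1-2q) >= 1], hence [2q/(1-2q) <= c],
    which pays for the missing power of c. *)
Lemma supersol_exists (K : realFieldType) (p q : K) (s : nat) :
  (0 < q)%R -> (q < p)%R -> (p < 2^-1)%R -> (4 * p * (1 - p) < 2^-1)%R ->
  exists2 H, supersol (1 - q)%R q s H &
    forall m, s < m -> (H m 0 <= 2 * q * (4 * p * (1 - p)) ^+ s)%R.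
Proof.
move=> q0 qp p_lt c_lt; have q2 : (2 * q < 1)%R by lra.
have zE : (2 * q * (2 * q)^-1 = 1)%R by rewrite mulfV //; lra.
have rc : (4 * q * (1 - q) <= 4 * p * (1 - p))%R.
  have : (0 <= (p - q) * (1 - p - q))%R by apply: mulr_ge0; lra.
  lra.
have r0 : (0 <= 4 * q * (1 - q))%R by rewrite !mulr_ge0 //; lra.
case: s => [|e].
  have [H HH Hm] := supersol0 q0 q2 zE erefl; exists H => // m m0.
  apply: le_trans (Hm _ m0) _; rewrite expr0 mulr1 mulrC ler_pM2r //.
  have h : (2^-1 <= (1 - 2 * q) ^+ 2)%R by lra.
  rewrite -[X in (_ <= X)%R]invrK lef_pV2 ?posrE ?invr_gt0 //.
  by apply: lt_le_trans h; rewrite invr_gt0.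
have [H HH Hm] := supersolS q0 q2 zE erefl e; exists H => // m m0.
apply: le_trans (Hm _ m0) _.
have le1 : ((4 * q * (1 - q)) ^+ e <= (4 * p * (1 - p)) ^+ e)%R.
  by apply: lerXn2r; rewrite ?nnegrE //; apply: le_trans rc.
have le2 : (4 * q ^+ 2 / (1 - 2 * q) <= 2 * q * (4 * p * (1 - p)))%R.
  rewrite ler_pdivrMr; last by lra.
  have -> : (4 * q ^+ 2 = 2 * q * (2 * q))%R by ring.
  rewrite -[X in (_ <= X)%R]mulrA ler_pM2l; last by lra.
  have : (2 * q <= 2 * p * (2 * (1 - p) * (1 - 2 * q)))%R.
    nra.
  lra.
have t0 : (0 <= 4 * q ^+ 2 / (1 - 2 * q))%R.
  by apply: divr_ge0; [rewrite mulr_ge0 // exprn_ge0 // ltW|lra].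
have -> : (4 * q ^+ 2 * (4 * q * (1 - q)) ^+ e / (1 - 2 * q) =
  4 * q ^+ 2 / (1 - 2 * q) * (4 * q * (1 - q)) ^+ e)%R by ring.
by rewrite [X in (_ <= _ * X)%R]exprS [X in (_ <= X)%R]mulrA; apply: ler_pM => //; apply: exprn_ge0.
Qed.

(** * Counting the orders behind a colouring *)

Section Colourings.
Variable U : finType.
Implicit Types (sigma : {perm U}) (f : {ffun U -> option bool}) (i x : U) (t : nat).

Lemma order_surj (s : seq U) : perm_eq s (enum U) ->
  exists sigma : {perm U}, Defs.order sigma = s.
Proof.
move=> ps; have ss : size s = size (enum U) := perm_size ps.
have us : uniq s by rewrite (perm_uniq ps) enum_uniq.
pose g x := nth x s (index x (enum U)).
have lt x : index x (enum U) < size s by rewrite ss index_mem mem_enum.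
have gI : injective g.
  move=> x y; rewrite /g (set_nth_default y x (lt x)) => /eqP.
  rewrite nth_uniq // => /eqP E.
  by rewrite -[x](nth_index x (mem_enum _ x)) E nth_index ?mem_enum.
exists (perm gI); case Es: s ss => [|x0 s'] ss.
  by apply: size0nil; rewrite size_map -ss.
apply: (@eq_from_nth _ x0) => [|k]; rewrite size_map -ss -Es // => ks.
have ke : k < size (enum U) by rewrite -ss -Es.
rewrite (nth_map x0) // permE /g index_uniq ?enum_uniq //.
by apply: set_nth_default.
Qed.

Definition coloring_of sigma t i : {ffun U -> option bool} :=
  let ord := Defs.order sigma in
  [ffun x => if index x ord < t then Some true
             else if index x ord < index i ord then Some false else None].

Definition color_class f i o := [set x | (f x == o) && (x != i)].

Lemma order_perm sigma : perm_eq (Defs.order sigma) (enum U).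
Proof.
apply: uniq_perm; rewrite ?enum_uniq ?(map_inj_uniq (@perm_inj _ sigma)) ?enum_uniq //.
by move=> x; rewrite mem_enum -[x](permKV sigma) map_f // mem_enum.
Qed.

Lemma col_at sigma t i : t <= index i (Defs.order sigma) -> coloring_of sigma t i i = None.
Proof. by move=> ti; rewrite ffunE ltnn ltnNge ti. Qed.

Lemma col_size sigma t i f : t <= index i (Defs.order sigma) -> coloring_of sigma t i = f ->
  t = #|color_class f i (Some true)|.
Proof.
move=> ti <-; set ord := Defs.order sigma in ti *.
have uo : uniq ord by rewrite (perm_uniq (order_perm _)) enum_uniq.
have mo x : x \in ord by rewrite (perm_mem (order_perm _)) mem_enum.
have -> : color_class (coloring_of sigma t i) i (Some true) = [set x in take t ord].
  apply/setP => x; rewrite !inE ffunE -/ord in_take //.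
  case: ltnP => xt; last by case: ifP.
  by apply: contraTneq xt => ->; rewrite -leqNgt.
rewrite cardsE (card_uniqP (take_uniq t uo)) size_takel //.
by apply: leq_trans ti (index_size _ _).
Qed.

(** Such an order lists the sampled class, the early class, [i], and the late class, each internally
    in any order. The value of [t] is forced to be the size of the sampled class. *)
Lemma card_col f i : f i = None ->
  #|[set sigma : {perm U} | (#|color_class f i (Some true)| <= index i (Defs.order sigma))
      && (coloring_of sigma #|color_class f i (Some true)| i == f)]| =
  #|color_class f i (Some true)|`! * #|color_class f i (Some false)|`! * #|color_class f i None|`!.
Proof.
move=> fi; set A := color_class f i (Some true); set C := color_class f i (Some false).
set N := color_class f i None; set T := [set _ | _].
pose PP := [seq (u, lb) | u <- [seq (la, lc) | la <- permutations (enum A),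
                                              lc <- permutations (enum C)],
                          lb <- permutations (enum N)].
pose gl (u : seq U * seq U * seq U) := u.1.1 ++ u.1.2 ++ i :: u.2.
have memPP u : (u \in PP) =
    [&& perm_eq u.1.1 (enum A), perm_eq u.1.2 (enum C) & perm_eq u.2 (enum N)].
  apply/allpairsP/and3P => [[[v z] /= [/allpairsP[[x y] /= [xA yC ->]] zN ->]]|[xA yC zN]].
    by rewrite /= -!mem_permutations.
  exists (u.1, u.2); rewrite /= mem_permutations zN; split=> //; last by case: (u).
  by apply/allpairsP; exists u.1; rewrite !mem_permutations xA yC; split=> //; case: (u.1).
have szPP u : u \in PP -> size u.1.1 = #|A| /\ size u.1.2 = #|C|.
  by rewrite memPP => /and3P[/perm_size -> /perm_size -> _]; rewrite -!cardE.
have uPP : uniq PP.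
  have up (T1 T2 : eqType) (s1 : seq T1) (s2 : seq T2) :
      uniq s1 -> uniq s2 -> uniq [seq (u, v) | u <- s1, v <- s2].
    by move=> u1 u2; apply: allpairs_uniq => // -[? ?] [? ?] _ _ /= [-> ->].
  have pu (B : {set U}) : uniq (permutations (enum B)) by apply: permutations_uniq.
  exact: (up _ _ _ _ (up _ _ _ _ (pu A) (pu C)) (pu N)).
have uY : uniq [seq gl u | u <- PP].
  rewrite map_inj_in_uniq // => -[[x y] z] [[x' y'] z'] /szPP[/= s1 s2] /szPP[/= s1' s2'].
  rewrite /gl /= => /eqP; rewrite eqseq_cat ?s1 // eqseq_cat ?s2 // eqseq_cons eqxx /=.
  by case/and3P=> /eqP -> /eqP -> /eqP ->.
have uX : uniq [seq Defs.order sigma | sigma <- enum T].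
  rewrite map_inj_uniq ?enum_uniq // => s1 s2 /eq_in_map E; apply/permP => x.
  by apply: E; rewrite mem_enum.
have -> : #|T| = size [seq Defs.order sigma | sigma <- enum T] by rewrite size_map -cardE.
have -> : #|A|`! * #|C|`! * #|N|`! = size [seq gl u | u <- PP].
  by rewrite size_map !size_allpairs !size_permutations ?enum_uniq // -!cardE.
have disj x : [/\ (x \in A) = (f x == Some true), (x \in C) = (f x == Some false)
    & (x \in N) = (f x == None) && (x != i)].
  by rewrite !inE; split=> //; case: (eqVneq x i) => [->|_]; rewrite ?fi ?andbT.
apply: perm_size; apply: uniq_perm => // s; apply/mapP/mapP.
- case=> sigma; rewrite mem_enum inE => /andP[ti /eqP cf] ->.
  set ord := Defs.order sigma in ti *.
  have uo : uniq ord by rewrite (perm_uniq (order_perm _)) enum_uniq.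
  have mo x : x \in ord by rewrite (perm_mem (order_perm _)) mem_enum.
  have cx x : f x = if index x ord < #|A| then Some true
             else if index x ord < index i ord then Some false else None.
    by rewrite -cf ffunE.
  set k := index i ord in ti cx *; set a := #|A| in ti cx *.
  have iord : index i ord < size ord by rewrite index_mem.
  have Eo : ord = take a ord ++ drop a (take k ord) ++ i :: drop k.+1 ord.
    rewrite catA -{1}(take_takel ord ti) cat_take_drop.
    by rewrite -{1}(cat_take_drop k ord) (drop_nth i iord) nth_index.
  move: (uo); rewrite {1}Eo cat_uniq => /and3P[u1 h1 ].
  rewrite cat_uniq => /and3P[u2 h2 /= /andP[h3 u3]].
  have idx x : index x ord = index x (take a ord ++ drop a (take k ord) ++ i :: drop k.+1 ord).
    by rewrite -Eo.
  have m1 x : (x \in take a ord) = (f x == Some true).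
    by rewrite in_take // cx; case: ifP => // _; case: ifP.
  have mk x : (x \in take k ord) = (x \in take a ord) || (x \in drop a (take k ord)).
    by rewrite -{1}(cat_take_drop a (take k ord)) take_takel // mem_cat.
  have m2 x : (x \in drop a (take k ord)) = (f x == Some false).
    have := mk x; rewrite in_take // m1 cx.
    have d12 : x \in drop a (take k ord) -> x \notin take a ord.
      by move=> xd; move/hasPn: h1; apply; rewrite mem_cat xd.
    rewrite in_take // in d12.
    case: ltnP d12 => xa d12; last by case: ltnP => _ /= <-.
    by move=> _; apply/negbTE/negP => /d12.
  have m3 x : (x \in drop k.+1 ord) = (f x == None) && (x != i).
    have : x \in ord := mo x; rewrite {1}Eo !mem_cat inE m1 m2.
    have d13 : x \in drop k.+1 ord -> ~~ ((f x == Some true) || (f x == Some false) || (x == i)).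
      move=> xd; rewrite -m1 -m2 !negb_or -andbA; apply/and3P; split.
      - by move/hasPn: h1; apply; rewrite mem_cat inE xd !orbT.
      - by move/hasPn: h2; apply; rewrite inE xd orbT.
      - by apply: contraNneq h3 => <-.
    case: (x \in drop _ _) d13 => [/(_ isT)|_]; case: (eqVneq x i) => //=;
      by case: (f x) => [[]|].
  exists (take a ord, drop a (take k ord), drop k.+1 ord) => //.
  rewrite memPP /=; apply/and3P; split; apply: uniq_perm; rewrite ?enum_uniq // => x;
    rewrite mem_enum; have [e1 e2 e3] := disj x;
    by rewrite ?e1 ?m1 ?e2 ?m2 ?e3 ?m3.
case=> [[[la lc] lb]]; rewrite memPP /gl /= => /and3P[pA pC pN] Es.
have mA x : (x \in la) = (f x == Some true).
  by rewrite (perm_mem pA) mem_enum; have [-> _ _] := disj x.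
have mC x : (x \in lc) = (f x == Some false).
  by rewrite (perm_mem pC) mem_enum; have [_ -> _] := disj x.
have mN x : (x \in lb) = (f x == None) && (x != i).
  by rewrite (perm_mem pN) mem_enum; have [_ _ ->] := disj x.
have us : uniq s.
  rewrite Es cat_uniq (perm_uniq pA) enum_uniq /=; apply/andP; split.
    apply/hasPn => x; rewrite mem_cat inE mC mN /= mA.
    by case/or3P=> [/eqP -> //|/eqP -> |/andP[/eqP ->]]; rewrite ?fi.
  rewrite cat_uniq (perm_uniq pC) enum_uniq /= (perm_uniq pN) enum_uniq andbT.
  rewrite mC fi /= mN eqxx andbF andbT; apply/hasPn => x; rewrite mN /= mC.
  by case/andP=> /eqP ->.
have [sigma Eo] : exists sigma : {perm U}, Defs.order sigma = s.
  apply: order_surj; apply: uniq_perm; rewrite ?enum_uniq // => x.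
  rewrite mem_enum Es !mem_cat inE mA mC mN; case: (eqVneq x i) => [->|_] /=; first by rewrite !orbT.
  by case: (f x) => [[]|].
have sA : size la = #|A| by rewrite (perm_size pA) -cardE.
have ii : index i s = size la + size lc.
  by rewrite Es !index_cat mA mC fi /= eqxx addn0.
exists sigma => //; rewrite mem_enum inE Eo ii -sA leq_addr /=.
apply/eqP/ffunP => x; rewrite ffunE Eo ii Es !index_cat mA mC.
case fx: (f x) => [[]|] /=.
- by rewrite ifT // index_mem mA fx.
- rewrite ifF; last by rewrite ltnNge leq_addr.
  by rewrite ltn_add2l index_mem mC fx.
rewrite ifF; last by rewrite ltnNge leq_addr.
by rewrite ifF // ltn_add2l ltnNge leq_addr.
Qed.

End Colourings.

(** * The law of the colouring seen by [i] *)

Section Law.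
Local Open Scope ring_scope.
Variables (U : finType) (p : R) (i : U).
Implicit Types (sigma : {perm U}) (f : {ffun U -> option bool}).

Definition coef (n t : nat) : R := ('C(n, t)%:R * (1 - p) ^+ t * p ^+ (n - t))%R.

(** Expectation restricted to the event that [i] lies in T, without normalisation; its total mass is
    [p]. *)
Definition perm_mean (g : {ffun U -> option bool} -> R) : R :=
  (\sum_(sigma : {perm U}) (#|U|`!)%:R^-1 *
    \sum_(t < #|U|.+1 | (t <= index i (Defs.order sigma))%N)
      coef #|U| t * g (coloring_of sigma t i))%R.

Lemma card_classes f : f i = None ->
  (#|color_class f i (Some true)| + #|color_class f i (Some false)| + #|color_class f i None|).+1 = #|U|.
Proof.
move=> fi; rewrite -cardsT [in RHS](cardsD1 i) inE add1n; congr _.+1.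
have E o : #|color_class f i o| = (\sum_(x in [set: U] :\ i) (f x == o))%N.
  rewrite -sum1_card big_mkcond [RHS]big_mkcond /=; apply: eq_bigr => x _.
  by rewrite !inE andbT; case: (f x == o); case: (x != i).
rewrite !E -!big_split /= -sum1_card; apply: eq_bigr => x _.
by case: (f x) => [[]|].
Qed.

Lemma prod_wt (a b c : R) f :
  \prod_(y | y != i) wt a b c (f y) =
  a ^+ #|color_class f i (Some true)| * (b ^+ #|color_class f i (Some false)| * c ^+ #|color_class f i None|).
Proof.
rewrite (partition_big f predT) //= (bigD1 (Some true)) //= (bigD1 (Some false)) //=.
rewrite (bigD1 None) //= [X in _ * (_ * (_ * X))]big1 ?mulr1; last by move=> [[]|].
have E o : \prod_(y | (y != i) && (f y == o)) wt a b c (f y) = wt a b c o ^+ #|color_class f i o|.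
  rewrite -prodr_const; apply: eq_big => [y|y /andP[_ /eqP ->] //].
  by rewrite inE andbC.
by rewrite !E.
Qed.

Lemma perm_meanE g : perm_mean g = \sum_(f : {ffun U -> option bool} | f i == None)
  (#|color_class f i (Some false)|`!%:R * #|color_class f i None|`!%:R /
     (#|color_class f i (Some false)| + #|color_class f i None|).+1`!%:R
   * p ^+ (#|color_class f i (Some false)| + #|color_class f i None|).+1)
   * ((1 - p) ^+ #|color_class f i (Some true)| * g f).
Proof.
pose good sigma (t : 'I_#|U|.+1) f := (t <= index i (Defs.order sigma))%N && (coloring_of sigma t i == f).
transitivity (\sum_(f : {ffun U -> option bool} | f i == None) \sum_(sigma : {perm U}) \sum_(t < #|U|.+1 | good sigma t f)
    (#|U|`!)%:R^-1 * (coef #|U| t * g f)).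
  rewrite exchange_big /=; apply: eq_bigr => sigma _.
  rewrite mulr_sumr (partition_big (fun t : 'I__ => coloring_of sigma t i) (fun f => f i == None)) /=;
    last by move=> t /col_at ->.
  by apply: eq_bigr => f _; apply: eq_bigr => t /andP[_ /eqP ->].
apply: eq_bigr => f /eqP fi.
have cU := card_classes fi; have cc := card_col fi.
set A := #|color_class f i (Some true)| in cU cc *; set C := #|color_class f i (Some false)| in cU cc *.
set N := #|color_class f i None| in cU cc *.
have AU : (A < #|U|.+1)%N by rewrite -cU; clear; lia.
transitivity (\sum_(sigma in [set sigma : {perm U} | (A <= index i (Defs.order sigma))%N
      && (coloring_of sigma A i == f)]) (#|U|`!)%:R^-1 * (coef #|U| A * g f)).
  rewrite [RHS]big_mkcond /=; apply: eq_bigr => sigma _; rewrite inE.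
  case: ifP => [gd|ngd].
    rewrite (big_pred1 (Ordinal AU)) // => t /=; rewrite /good.
    apply/andP/eqP => [[ti /eqP cf]|->]; last by move/andP: gd.
    by apply: val_inj; apply: col_size ti cf.
  rewrite big_pred0 // => t; apply: contraFF ngd => /andP[ti /eqP cf].
  have E : t = A :> nat := col_size ti cf.
  by rewrite -E ti cf eqxx.
rewrite sumr_const cc /coef -cU.
have -> : ((A + C + N).+1 - A = (C + N).+1)%N by clear; lia.
have bf : ('C((A + C + N).+1, A) * (A`! * ((C + N).+1)`!) = ((A + C + N).+1)`!)%N.
  rewrite -[in LHS](_ : ((A + C + N).+1 - A = (C + N).+1)%N); last by clear; lia.
  by apply: bin_fact; clear; lia.
have nz k : (k`!)%:R != 0 :> R by rewrite pnatr_eq0 -lt0n fact_gt0.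
have bz : 'C((A + C + N).+1, A)%:R != 0 :> R.
  by rewrite pnatr_eq0 -lt0n bin_gt0; clear; lia.
rewrite -bf; move: bz; move: 'C(_, _) (C + N).+1 => B M bz.
rewrite -[_ *+ _]mulr_natl !natrM.
by field; rewrite !nz bz.
Qed.

Lemma is_RInt_sum (I : Type) (s : seq I) (P : pred I) (h : I -> R -> R) (v : I -> R) (a b : R) :
  (forall k, is_RInt (h k) a b (v k)) ->
  is_RInt (fun y => \sum_(k <- s | P k) h k y) a b (\sum_(k <- s | P k) v k).
Proof.
move=> H; elim: s => [|k s IH].
  rewrite big_nil; apply: (@is_RInt_ext R_NormedModule (fun=> zero)) => [x _|]; first by rewrite big_nil.
  by have := @is_RInt_const R_NormedModule a b zero; rewrite scal_zero_r.
rewrite big_cons; case: ifP => Pk; last first.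
  by apply: is_RInt_ext IH => x _; rewrite big_cons Pk.
apply: (@is_RInt_ext R_NormedModule (fun y => plus (h k y) (\sum_(k <- s | P k) h k y))).
  by move=> x _; rewrite big_cons Pk.
exact: is_RInt_plus (H k) IH.
Qed.

(** The factorials left by the count form a Beta integral. Equivalently, arrival times are
    independent and uniform: [y] is the time elapsed in the window of length [p] when [i] arrives,
    and the omitted factor of [i] becomes dy. *)
Lemma perm_mean_RInt g :
  is_RInt (fun y => Zcol (1 - p) y (p - y) i None g) 0 p (perm_mean g).
Proof.
rewrite perm_meanE; rewrite /Zcol; apply: is_RInt_sum => f.
rewrite [X in is_RInt _ _ _ X]mulrC.
apply: (@is_RInt_ext R_NormedModule (fun y => scal ((1 - p) ^+ #|color_class f i (Some true)| * g f)
  ((y ^ #|color_class f i (Some false)|)%Re * ((p - y) ^ #|color_class f i None|)%Re)%Re)).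
  move=> y _; rewrite prod_wt !RpowE /scal /= /mult /=.
  by rewrite RminusE !RmultE; ring.
apply: is_RInt_scal.
have := @is_RInt_beta p #|color_class f i (Some false)| #|color_class f i None|.
by rewrite !INRE !factE RpowE.
Qed.

End Law.

(** * Probability of a successful walk *)

Section WalkProbability.
Local Open Scope ring_scope.
Variables (U : finType) (F : {set {set U}}) (mu : {set U} -> nat) (p : R).
Hypotheses (p_gt0 : 0 < p) (p_lt : p < 2^-1) (c_lt : 4 * p * (1 - p) < 2^-1).

Lemma supersol_scale (K : realFieldType) (a b : K) s H : 0 < a -> 0 <= b ->
  supersol (1 - b / (a + b)) (b / (a + b)) s H -> supersol a b s H.
Proof.
move=> a0 b0 [H0 H1 H2]; split=> // u d; have := H2 u d.
have ab : 0 < a + b by lra.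
have Ea : a = (a + b) * (1 - b / (a + b)) by field; lra.
have Eb : b = (a + b) * (b / (a + b)) by field; lra.
move: (b / _) Ea Eb => k Ea Eb /(ler_wpM2l (ltW ab)).
by rewrite mulrDr !mulrA -Ea -Eb mulrDr -Ea -Eb.
Qed.

(** Integrate the bound [2 q c^s] over [y], where [q = y/(1-p+y)] is the chance that an element
    moving the walk is early. *)
Lemma perm_mean_walk (s r : nat) (B : {set U}) l i :
  B \in F -> mu B = (s.+1 + r)%N -> uniq l -> {subset l <= B} -> i \notin l ->
  perm_mean p i (fun f => (walk F mu (mu B) r f l set0 0)%:R)
    <= 2 * (4 * p * (1 - p)) ^+ s * (p + (1 - p) * ln (1 - p)).
Proof.
move=> BF mE ul lB il; set c := 4 * p * (1 - p).
have p1 : p < 1 by have := p_lt; lra.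
have p01 : (0 < p < 1)%Re by split; apply/RltP.
have h2 : is_RInt (fun y : R => 2 * c ^+ s * (y / (1 - p + y)))%R 0%Re p
    (2 * c ^+ s * (p + (1 - p) * ln (1 - p)))%R.
  apply: is_RInt_ext (is_RInt_scal _ _ _ (2 * c ^+ s) _ (is_RInt_ratio p01)) => y _.
  by rewrite -RdivE.
have p_le : (0 <= p)%Re by apply/RleP/ltW.
apply/RleP; apply: (is_RInt_le _ _ _ _ _ _ p_le (@perm_mean_RInt U p i _) h2).
move=> y [/RltP y0 /RltP yp]; apply/RleP.
have y0' : 0 < y by [].
have ig : indep_at i (fun f => (walk F mu (mu B) r f l set0 0)%:R : R).
  move=> f f' E; congr (_%:R); congr nat_of_bool; apply: eq_walk => x xl.
  by apply: E; apply: contraNneq il => <-.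
rewrite -(Ecol_Zcol _ None ig); last by ring.
set q := y / (1 - p + y).
have ab : 0 < 1 - p + y by lra.
have q0 : 0 < q by apply: divr_gt0.
have qp : q < p by rewrite /q ltr_pdivrMr //; nra.
have [H HH Hm] := supersol_exists s q0 qp p_lt c_lt.
have HH' : supersol (1 - p) y s H.
  by apply: supersol_scale; rewrite -/q //; lra.
have a0 : 0 <= 1 - p by lra.
have c0 : 0 <= p - y by lra.
have abc : (1 - p) + y + (p - y) = 1 by ring.
have hw := @Ecol_walk _ U _ _ _ a0 (ltW y0) c0 abc F mu s (mu B) r H B l set0 0%N
  HH' mE BF erefl ul lB (sub0set _).
apply: le_trans (hw _) _; first by move=> x _; rewrite inE.
rewrite cards0 subn0 mE; apply: le_trans (Hm _ _) _; first by rewrite ltn_addr.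
by rewrite le_eqVlt; apply/orP; left; apply/eqP; rewrite -/c; ring.
Qed.

Lemma perm_mean1 (i : U) : perm_mean p i (fun=> 1) = p.
Proof.
have h1 := @perm_mean_RInt U p i (fun=> 1%R).
have E : forall y : R, Zcol (1 - p) y (p - y) i None (fun=> 1) = 1.
  move=> y; rewrite -(@Ecol_Zcol _ _ (1 - p) y (p - y) _ i None (fun=> 1)) ?Ecol_cst //; by ring.
have h2 : is_RInt (fun=> 1 : R) 0 p (perm_mean p i (fun=> 1)).
  by apply: is_RInt_ext h1 => y _; rewrite E.
have h3 := @is_RInt_const R_NormedModule 0%Re p 1%Re.
rewrite -(is_RInt_unique _ _ _ _ h2) (is_RInt_unique _ _ _ _ h3).
by rewrite /scal /= /mult /=; rewrite RmultE RminusE mulr1 subr0.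
Qed.

End WalkProbability.

(** * Size of a laminar family *)

Section Amortisation.
Variable U : finType.
Implicit Types (X Y A B : {set U}) (P : {set {set U}}).

(** Deleting a point [x] keeps the family laminar and loses at most two members: the singleton of
    [x], and one set merging with its union with [x]. *)
Lemma laminar_card P X : laminar P -> set0 \notin P ->
  (forall A, A \in P -> A \subset X) -> #|P| <= 2 * #|X|.
Proof.
elim: {X}#|X| {-2}X (erefl #|X|) P => [|n IH] X cX P lamP P0 PX.
  rewrite cX muln0 leqn0 cards_eq0; apply/eqP/setP => A; rewrite inE.
  apply/negP => AP; case/negP: P0; suff <- : A = set0 by [].
  by apply/eqP; rewrite -subset0 -(cards0_eq cX) PX.
have [x xX] : exists x, x \in X by apply/set0Pn; rewrite -card_gt0 cX.
pose tr A := A :\ x; pose P' := (tr @: P) :\ set0.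
have bound : #|P'| <= 2 * n.
  have cX' : #|X :\ x| = n by move: cX; rewrite (cardsD1 x) xX => -[].
  rewrite -cX'; apply: (IH _ cX'); last first.
  - move=> A; rewrite inE => /andP[_ /imsetP[B BP ->]]; exact: setSD (PX _ BP).
  - by rewrite !inE eqxx.
  move=> _ _ /setD1P[_ /imsetP[A AP ->]] /setD1P[_ /imsetP[B BP ->]].
  case/or3P: (lamP _ _ AP BP) => S; apply/or3P.
  - by constructor 1; apply: setSD.
  - by constructor 2; apply: setSD.
  - constructor 3; apply: disjointWl (subsetDl _ _) _.
    exact: disjointWr (subsetDl _ _) S.
pose Q := [set A in P | (x \notin A) && (x |: A \in P)].
have Q1 : #|Q| <= 1.
  rewrite leqNgt; apply/negP => /card_gt1P[A [B [AQ BQ AB]]].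
  (* [Z] meets [x |: Y] because [Y] is nonempty, so the two are comparable; as [x] is not in [Z],
     this forces [Z] into [Y]. *)
  have key (Y Z : {set U}) : Y \in Q -> Z \in Q -> x |: Y \subset x |: Z -> Y = Z.
    rewrite !inE => /and3P[YP xY xYP] /and3P[ZP xZ xZP] S.
    have YZ : Y \subset Z.
      apply/subsetP => y yY; have := subsetP S y; rewrite !inE yY orbT => /(_ isT).
      by case: eqVneq yY xY => // -> ->.
    have [y yY] : exists y, y \in Y by apply/set0Pn; apply: contraNneq P0 => <-.
    apply/eqP; rewrite eqEsubset YZ /=; case/or3P: (lamP _ _ ZP xYP) => S'.
    - apply/subsetP => z zZ; have := subsetP S' z zZ; rewrite !inE.
      by case: eqVneq zZ xZ => // -> ->.
    - by have := subsetP S' x; rewrite !inE eqxx (negbTE xZ) => /(_ isT).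
    - by move/pred0P: S' => /(_ y); rewrite /= !inE yY orbT (subsetP YZ).
  have xAP : x |: A \in P by move: AQ; rewrite inE => /and3P[].
  have xBP : x |: B \in P by move: BQ; rewrite inE => /and3P[].
  case/or3P: (lamP _ _ xAP xBP) => S.
  - by case/eqP: AB; apply: key.
  - by case/eqP: AB; apply/esym; apply: key.
  - by move/pred0P: S => /(_ x); rewrite /= !inE eqxx.
pose P1 := P :\: Q :\ [set x].
have P1P' : #|P1| <= #|P'|.
  have inj : {in P1 &, injective tr}.
    move=> A B; rewrite !inE => /and3P[Ax AQ AP] /and3P[Bx BQ BP] E.
    rewrite AP BP /= in AQ BQ.
    case: (boolP (x \in A)) (boolP (x \in B)) => xA [] xB.
    - by rewrite -(setD1K xA) -(setD1K xB) -![_ :\ x]/(tr _) E.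
    - case/negP: BQ; rewrite xB /= (_ : x |: B = A) //.
      by rewrite -(setD1K xA) -[A :\ x]/(tr A) E /tr (setDidPl _) // disjoint_sym disjoints1.
    - case/negP: AQ; rewrite xA /= (_ : x |: A = B) //.
      by rewrite -(setD1K xB) -[B :\ x]/(tr B) -E /tr (setDidPl _) // disjoint_sym disjoints1.
    have trid (Z : {set U}) : x \notin Z -> tr Z = Z.
      by move=> xZ; apply/setDidPl; rewrite disjoint_sym disjoints1.
    by rewrite -(trid A) // E trid.
  rewrite -(card_in_imset inj); apply: subset_leq_card; apply/subsetP => Z.
  case/imsetP => A; rewrite !inE => /and3P[Ax AQ AP] ->; rewrite imset_f // andbT.
  apply: contraNneq P0; rewrite /tr => E.
  have : A \subset [set x] by rewrite -setD_eq0 E.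
  by rewrite subset1 (negbTE Ax) /= => /eqP <-.
have : #|P| <= #|P1| + 2.
  rewrite -(cardsID Q P) addnC; apply: (@leq_trans (#|P :\: Q| + 1)).
    by rewrite leq_add2l; apply: leq_trans Q1; apply: subset_leq_card; apply: subsetIr.
  by rewrite (cardsD1 [set x] (P :\: Q)) /P1; case: (_ \in _); move: #|_| => k; clear; lia.
by move=> /leq_trans; apply; rewrite cX mulnS addnC leq_add2l (leq_trans P1P').
Qed.

End Amortisation.

(** * Geometric series and Abel summation *)

Section GeometricSums.
Local Open Scope ring_scope.
Variables (K : realFieldType) (c : K).
Hypotheses (c_ge0 : 0 <= c) (c_lt1 : c < 1).

Lemma geometric_inj (T : finType) (P : {set T}) (g : T -> nat) :
  {in P &, injective g} -> \sum_(x in P) c ^+ g x <= (1 - c)^-1.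
Proof.
move=> gI; pose N := (\max_(x in P) g x).+1.
have gN x : x \in P -> (g x < N)%N by move=> xP; rewrite ltnS; apply: leq_bigmax_cond.
have geo n : \sum_(k < n) c ^+ k <= (1 - c)^-1.
  have E : (1 - c) * \sum_(k < n) c ^+ k = 1 - c ^+ n.
    by rewrite -{2}(expr1n _ n) subrXX; congr (_ * _); apply: eq_bigr => k _;
      rewrite expr1n mul1r.
  have c1 : 0 < 1 - c by rewrite subr_gt0.
  by rewrite -[X in _ <= X]mul1r ler_pdivlMr // mulrC E gerBl exprn_ge0.
apply: le_trans (geo N).
rewrite (partition_big (fun x => inord (g x) : 'I_N) predT) //=.
apply: ler_sum => k _; case: (pickP [pred x | (x \in P) && (inord (g x) == k :> 'I_N)]).
  move=> x /= /andP[xP /eqP xk]; rewrite (big_pred1 x).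
    by rewrite -xk inordK //; exact: gN.
  move=> y /=; apply/andP/eqP => [[yP /eqP yk]|->]; last by rewrite xk.
  apply: gI => //; have := congr1 val yk; rewrite -xk /= !inordK //; exact: gN.
by move=> none; rewrite big_pred0 ?exprn_ge0.
Qed.

(* Abel summation *)
Lemma sum_upper_sets (T : finType) (w e : T -> K) (O : {set T}) :
  (forall x, x \in O -> 0 <= w x) ->
  (forall Y : {set T}, Y \subset O ->
     (forall x y, x \in Y -> y \in O -> w x < w y -> y \in Y) ->
     0 <= \sum_(x in Y) e x) ->
  0 <= \sum_(x in O) w x * e x.
Proof.
elim: {O}#|O| {-2}O (erefl #|O|) w => [|n IH] O cO w w0 H.
  by rewrite (cards0_eq cO) big_set0.
have [x0 x0O] : exists x, x \in O by apply/set0Pn; rewrite -card_gt0 cO.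
case: (@Order.TotalTheory.arg_minP _ _ _ x0 (fun x => x \in O) w x0O) => m mO minm.
have -> : \sum_(x in O) w x * e x =
    w m * (\sum_(x in O) e x) + \sum_(x in O :\ m) (w x - w m) * e x.
  rewrite mulr_sumr !(big_setD1 m mO) /= -addrA -big_split /=; congr (_ + _).
  by apply: eq_bigr => x _; ring.
apply: addr_ge0; first by apply: mulr_ge0; [exact: w0|apply: H].
apply: (IH _ _ (fun x => w x - w m)).
- by move: cO; rewrite (cardsD1 m) mO => -[].
- by move=> x; rewrite !inE subr_ge0 => /andP[_ /minm].
move=> Y YO up; apply: H; first exact: subset_trans YO (subD1set _ _).
move=> x y xY yO xy; apply: (up _ _ xY); last by rewrite ltrD2r.
rewrite !inE yO andbT; apply: contraTneq xy => ->.
by rewrite -leNgt; apply: minm; have := subsetP YO _ xY; rewrite inE => /andP[].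
Qed.

End GeometricSums.

(** * Amortising the losses over OPT *)

Section Charging.
Local Open Scope ring_scope.
Variables (K : realFieldType) (c : K).
Hypotheses (c_ge0 : 0 <= c) (c_lt1 : c < 1).
Variables (U : finType) (w : U -> R) (F : {set {set U}}) (mu : {set U} -> nat).
Hypothesis lamF : laminar F.
Hypothesis w_inj : injective w.
Hypothesis mu_mono :
  forall A B, A \in F -> B \in F -> A \proper B -> (mu A < mu B)%N.
Implicit Types (X Y A B O : {set U}).

Definition slack O B i := (mu B - #|[set x in O :&: B | (w i < w x)%R]|.+1)%N.

(** The slack of [i] is [mu B - #|Y :&: B|] plus the number of lighter elements of [Y :&: B]; these
    exponents are distinct. *)
Lemma sum_slack_in Y B : (#|Y :&: B| <= mu B)%N ->
  \sum_(i in Y :&: B) c ^+ slack Y B i <= c ^+ (mu B - #|Y :&: B|) / (1 - c).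
Proof.
move=> le; pose g i := #|[set x in Y :&: B | w x < w i]|.
rewrite (eq_bigr (fun i => c ^+ (mu B - #|Y :&: B|) * c ^+ g i)); last first.
  move=> i iY; rewrite -exprD; congr (_ ^+ _); rewrite /slack.
  have E : #|Y :&: B| = (#|[set x in Y :&: B | (w i < w x)%R]|.+1 + g i)%N.
    rewrite (cardsD1 i) iY add1n addSn; congr _.+1.
    rewrite -(cardsID [set x | w i < w x] (_ :\ i)); congr (_ + _)%N; apply: eq_card => x.
      by rewrite !inE; case: (eqVneq x i) => [->|_] //=; rewrite ltxx andbF.
    rewrite !inE; case: (eqVneq x i) => [->|nx] /=; first by rewrite ltxx !andbF.
    rewrite -leNgt lt_neqAle andbC (_ : w x != w i) //.
    by apply: contraNneq nx => /w_inj ->.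
  by move: le; rewrite E; move: #|_| (g i) => u v; clear; lia.
rewrite -mulr_sumr; apply: ler_wpM2l; first exact: exprn_ge0.
apply: geometric_inj => // i j iY jY E.
have lt_g a b : a \in Y :&: B -> w a < w b -> (g a < g b)%N.
  move=> aY ab; apply: proper_card; apply/properP; split.
    apply/subsetP => x; rewrite !inE => /andP[-> xa]; exact: lt_trans xa ab.
  by exists a; rewrite !inE ?ab ?ltxx ?andbF // andbT; move: aY; rewrite inE.
apply: w_inj; apply/eqP; rewrite eq_le !leNgt; apply/andP; split; apply/negP => lt.
  by have := lt_g _ _ jY lt; rewrite E ltnn.
by have := lt_g _ _ iY lt; rewrite E ltnn.
Qed.

(** After summing within each [B], group the sets by their nonempty trace on [Y]. Sets with equal
    trace share a point, hence form a chain with distinct capacities and give a second geometric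
    series. The traces are laminar, so there are at most [2 #|Y|] of them. *)
Lemma sum_slack Y : indep F mu Y ->
  \sum_(i in Y) \sum_(B in F | i \in B) c ^+ slack Y B i <=
  2 * #|Y|%:R / (1 - c) ^+ 2.
Proof.
move=> iY; have iYB B : B \in F -> (#|Y :&: B| <= mu B)%N by move/indepP: iY; apply.
have i1c : 0 <= (1 - c)^-1 by rewrite invr_ge0 subr_ge0 ltW.
rewrite (exchange_big_dep (fun B => B \in F)) /=; last by move=> i B _ /andP[].
pose G := [set B in F | Y :&: B != set0].
apply: (@le_trans _ _ (\sum_(B in G) c ^+ (mu B - #|Y :&: B|) / (1 - c))).
  rewrite (bigID (fun B => Y :&: B != set0)) /= [X in _ + X]big1 ?addr0; last first.
    move=> B /andP[_ /negPn/eqP YB]; rewrite big_pred0 // => i.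
    apply/negP => /and3P[iYi _ iB]; have := in_set0 i.
    by rewrite -YB inE iYi iB.
  rewrite [X in _ <= X](eq_bigl (fun B => (B \in F) && (Y :&: B != set0))); last first.
    by move=> B; rewrite inE.
  apply: ler_sum => B /andP[BF _]; apply: le_trans (sum_slack_in (iYB _ BF)).
  rewrite le_eqVlt; apply/orP; left; apply/eqP; apply: eq_bigl => i.
  by rewrite inE BF.
rewrite -mulr_suml expr2 invfM mulrA; apply: ler_wpM2r => //.
pose tr B := Y :&: B.
rewrite (partition_big tr (fun A => A \in tr @: G)) /=; last by move=> B BG; apply: imset_f.
have chain A : A \in tr @: G ->
    \sum_(B in G | tr B == A) c ^+ (mu B - #|Y :&: B|) <= (1 - c)^-1.
  case/imsetP => B0 B0G EA.
  rewrite (eq_bigl (fun B => B \in [set B in G | tr B == A])); last by move=> B; rewrite !inE.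
  apply: geometric_inj => // B1 B2; rewrite !inE.
  case/andP=> /andP[F1 N1] /eqP E1 /andP[/andP[F2 N2] /eqP E2].
  rewrite -/(tr B1) -/(tr B2) E1 E2 => E.
  have c1 : (#|A| <= mu B1)%N by rewrite -E1 iYB.
  have c2 : (#|A| <= mu B2)%N by rewrite -E2 iYB.
  have {}E : mu B1 = mu B2 by move: c1 c2 E; clear; lia.
  have [x xA] := set0Pn _ N1.
  have xB1 : x \in B1 by move: xA; rewrite inE => /andP[].
  have xB2 : x \in B2.
    by move: xA; rewrite -/(tr B1) E1 -E2 inE => /andP[].
  case/or3P: (lamF F1 F2) => S.
  - case: (eqVneq B1 B2) => // ne; have := mu_mono F1 F2.
    by rewrite properEneq ne S E ltnn => /(_ isT).
  - case: (eqVneq B2 B1) => // ne; have := mu_mono F2 F1.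
    by rewrite properEneq ne S E ltnn => /(_ isT).
  - by move/pred0P: S => /(_ x); rewrite /= xB1 xB2.
apply: le_trans (ler_sum _ chain) _.
rewrite sumr_const -[X in X <= _]mulr_natl; apply: ler_wpM2r => //.
rewrite -natrM ler_nat; apply: laminar_card.
- move=> _ _ /imsetP[B1 + ->] /imsetP[B2 + ->]; rewrite !inE => /andP[F1 _] /andP[F2 _].
  case/or3P: (lamF F1 F2) => S; apply/or3P.
  + by constructor 1; apply: setIS.
  + by constructor 2; apply: setIS.
  + constructor 3; apply: disjointWl (subsetIr _ _) _.
    exact: disjointWr (subsetIr _ _) S.
- by apply/imsetP => -[B]; rewrite inE => /andP[_ +] E; rewrite -/(tr B) -E eqxx.
- by move=> _ /imsetP[B _ ->]; apply: subsetIl.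
Qed.

Lemma slack_upper O Y B i : Y \subset O -> i \in Y ->
  (forall x y, x \in Y -> y \in O -> w x < w y -> y \in Y) ->
  slack O B i = slack Y B i.
Proof.
move=> YO iY up; rewrite /slack; congr (_ - _.+1)%N; apply: eq_card => x; rewrite !inE.
case: (boolP (w i < w x)) => ix; rewrite ?andbF // !andbT; congr (_ && _).
by apply/idP/idP => [xO|]; [exact: up iY xO ix|exact: (subsetP YO)].
Qed.

End Charging.

(** Abel summation over the weights leaves the unweighted inequality for upper sets [Y] of [O], on
    which slacks relative to [O] and to [Y] coincide. *)
Lemma weighted_slack (U : finType) (w : U -> R) (F : {set {set U}})
    (mu : {set U} -> nat) (c : R) (O : {set U}) :
  laminar F -> injective w ->
  (forall A B, A \in F -> B \in F -> A \proper B -> mu A < mu B) ->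
  (forall x, (0 <= w x)%R) -> (0 <= c)%R -> (c < 1)%R -> indep F mu O ->
  (\sum_(i in O) w i * \sum_(B in F | i \in B) c ^+ slack w mu O B i
   <= 2 / (1 - c) ^+ 2 * \sum_(i in O) w i)%R.
Proof.
move=> lamF w_inj mono w0 c0 c1 iO; rewrite -subr_ge0 mulr_sumr -sumrB.
rewrite (eq_bigr (fun i => w i * (2 / (1 - c) ^+ 2 -
  \sum_(B in F | i \in B) c ^+ slack w mu O B i))%R); last by move=> i _; ring.
apply: sum_upper_sets => // Y YO up.
rewrite sumrB subr_ge0 sumr_const.
have -> : (2 / (1 - c) ^+ 2 *+ #|Y| = 2 * #|Y|%:R / (1 - c) ^+ 2)%R.
  by rewrite -[LHS]mulr_natl; ring.
apply: le_trans (sum_slack c0 c1 lamF w_inj mono (indepS YO iO)).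
rewrite le_eqVlt; apply/orP; left; apply/eqP; apply: eq_bigr => i iY.
by apply: eq_bigr => B _; rewrite (slack_upper _ _ YO iY up).
Qed.

(** * Linearity of the restricted expectation *)

Section Expectation.
Local Open Scope ring_scope.
Variables (U : finType) (p : R) (i : U).
Implicit Types (g h : {ffun U -> option bool} -> R).

Lemma perm_meanB g h : perm_mean p i (fun f => g f - h f)%R = perm_mean p i g - perm_mean p i h.
Proof.
rewrite /perm_mean -sumrB; apply: eq_bigr => sigma _; rewrite -mulrBr -sumrB.
by congr (_ * _); apply: eq_bigr => t _; rewrite -mulrBr.
Qed.

Lemma perm_mean_sum (I : finType) (P : pred I) (g : I -> {ffun U -> option bool} -> R) :
  perm_mean p i (fun f => \sum_(k | P k) g k f) = \sum_(k | P k) perm_mean p i (g k).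
Proof.
rewrite /perm_mean exchange_big /=; apply: eq_bigr => sigma _.
rewrite -mulr_sumr; congr (_ * _); rewrite exchange_big /=; apply: eq_bigr => t _.
by rewrite mulr_sumr.
Qed.

End Expectation.

(** * From rejection probabilities to expected weight *)

Section Main.
Local Open Scope ring_scope.
Variables (U : finType) (w : U -> R) (F : {set {set U}}) (mu : {set U} -> nat).
Variable opt : {set U} -> {set U} -> {set U}.
Variable p : R.
Hypothesis lamF : laminar F.
Hypothesis setTF : [set: U] \in F.
Hypothesis w_ge0 : forall x, 0 <= w x.
Hypothesis w_inj : injective w.
Hypothesis mu_mono :
  forall A B, A \in F -> B \in F -> A \proper B -> (mu A < mu B)%N.
Hypothesis optP : forall V B, is_opt w F mu V B (opt V B).
Hypotheses (p_gt0 : 0 < p) (p_lt : p < 2^-1) (c_lt : 4 * p * (1 - p) < 2^-1).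
Local Notation OPT := (opt [set: U] [set: U]).
Local Notation n := #|U|.

Lemma binomE m t : (t <= m)%N -> Binomial.C m t = 'C(m, t)%:R.
Proof.
move=> tm; rewrite /Binomial.C !INRE !factE RdivE RmultE -(bin_fact tm) !natrM.
have nz k : (k`!)%:R != 0 :> R by rewrite pnatr_eq0 -lt0n fact_gt0.
by field; rewrite !nz.
Qed.

Lemma expected_wSOLE : expected_wSOL w F mu opt p =
  \sum_(sigma : {perm U}) (n`!)%:R^-1 *
    \sum_(t < n.+1) coef p n t * \sum_(x in SOL w F mu opt sigma t) w x.
Proof.
rewrite /expected_wSOL foldr_Rplus big_enum; apply: eq_big => [s|sigma _]; first by rewrite inE.
rewrite RmultE RinvE INRE factE; congr (_ * _).
have -> : seq.iota 0%N n.+1 = index_iota 0%N n.+1 by rewrite /index_iota subn0.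
rewrite foldr_Rplus big_mkord.
apply: eq_bigr => t _.
rewrite binomE; last by rewrite -ltnS.
by rewrite /coef wsetE !RpowE !RmultE RminusE.
Qed.

Definition rank_in B i := #|[set x in OPT :&: B | w i < w x]|.

Definition heavy_first (B : {set U}) i : seq U :=
  path.sort (fun x y => w y <= w x) (enum (B :\ i)).

Lemma heavy_first_pairwise B i : pairwise (fun x y => w y < w x) (heavy_first B i).
Proof.
have tot : total (fun x y => w y <= w x) by move=> x y; apply: le_total.
have := sort_sorted tot (enum (B :\ i)).
rewrite sorted_pairwise => [pw|y x z xy yz]; last exact: le_trans yz xy.
have : uniq (heavy_first B i) by rewrite sort_uniq enum_uniq.
rewrite uniq_pairwise => un; have := conj pw un => /andP; rewrite -pairwise_relI.
apply: sub_pairwise => x y /andP[le ne].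
by rewrite lt_neqAle le andbT; apply: contraNneq ne => /w_inj ->.
Qed.

Definition walk_bad B i (f : {ffun U -> option bool}) : R :=
  (walk F mu (mu B) (rank_in B i) f (heavy_first B i) set0 0)%:R%R.

(** A union bound: if [i] is in T and missing from SOL, one of the walks succeeds and the left side
    is at most 0. *)
Lemma mem_SOL_ge sigma (t : nat) i : i \in OPT ->
  (if (t <= index i (Defs.order sigma))%N then
     1 - \sum_(B in F | i \in B) walk_bad B i (coloring_of sigma t i) else 0)
  <= (i \in SOL w F mu opt sigma t)%:R :> R.
Proof.
move=> iO; case: ifP => ti; last by rewrite ler0n.
have S0 : 0 <= \sum_(B in F | i \in B) walk_bad B i (coloring_of sigma t i).
  by apply: sumr_ge0 => B _; apply: ler0n.
have [->|[B [X [theta [BF iB fl]]]]] :=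
  SOL_or_fails lamF setTF w_ge0 w_inj optP ti.
  by rewrite lerBlDr lerDl.
apply: (@le_trans _ _ 0); last exact: ler0n.
rewrite subr_le0 (bigD1 B) /=; last by rewrite BF.
have -> : walk_bad B i (coloring_of sigma t i) = 1.
  rewrite /walk_bad (@fails_walk _ w F mu opt lamF w_ge0 w_inj mu_mono optP _ i B X theta) //.
  - suff [-> ->] : [set x | coloring_of sigma t i x == Some true] =
        [set x | (index x (Defs.order sigma) < t)%N] /\
      [set x | coloring_of sigma t i x == Some false] =
        [set x | (t <= index x (Defs.order sigma) < index i (Defs.order sigma))%N] by [].
    by split; apply/setP => x; rewrite !inE ffunE; case: ltnP => // _; case: ltnP.
  - exact: col_at.
  - by move=> Y iY YB Yi; exact: (opt_card_max_in lamF w_ge0 w_inj (optP _ _) iO BF iB iY YB Yi).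
  - exact: heavy_first_pairwise.
  - by move=> x; rewrite mem_sort mem_enum.
by rewrite lerDl sumr_ge0 // => A _; apply: ler0n.
Qed.

Lemma coef_ge0 m t : 0 <= coef p m t.
Proof.
by rewrite /coef !mulr_ge0 ?exprn_ge0 ?ler0n ?(ltW p_gt0) // subr_ge0; have := p_lt; lra.
Qed.

(** Linearity of expectation, discarding the weight of SOL outside OPT. *)
Lemma expected_ge_sum : \sum_(i in OPT) w i *
    (p - \sum_(B in F | i \in B) perm_mean p i (walk_bad B i))
  <= expected_wSOL w F mu opt p.
Proof.
have E i : p - \sum_(B in F | i \in B) perm_mean p i (walk_bad B i) =
    perm_mean p i (fun f => 1 - \sum_(B in F | i \in B) walk_bad B i f)%R.
  by rewrite perm_meanB perm_mean1 perm_mean_sum.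
under eq_bigr do rewrite E.
rewrite expected_wSOLE /perm_mean.
under eq_bigr do rewrite mulr_sumr.
rewrite exchange_big /=; apply: ler_sum => sigma _.
under eq_bigr do rewrite mulrCA.
rewrite -mulr_sumr; apply: ler_wpM2l; first by rewrite invr_ge0 ler0n.
rewrite [X in X <= _](eq_bigr (fun i => \sum_(t < n.+1)
    w i * (if (t <= index i (Defs.order sigma))%N then coef p n t *
      (1 - \sum_(B in F | i \in B) walk_bad B i (coloring_of sigma t i)) else 0)));
  last by move=> i _; rewrite big_mkcond mulr_sumr.
rewrite exchange_big /=; apply: ler_sum => t _.
apply: (@le_trans _ _ (\sum_(i in OPT) coef p n t * (w i * (i \in SOL w F mu opt sigma t)%:R))).
  apply: ler_sum => i iO; have := mem_SOL_ge sigma t iO; case: ifP => _ h.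
    by rewrite mulrCA; apply: (ler_wpM2l (coef_ge0 _ _)); apply: ler_wpM2l.
  by rewrite mulr0 mulr_ge0 ?coef_ge0 // mulr_ge0 ?ler0n.
rewrite -mulr_sumr; apply: (ler_wpM2l (coef_ge0 _ _)).
rewrite big_mkcond [X in _ <= X]big_mkcond; apply: ler_sum => x _.
by case: (x \in opt _ _); case: (x \in SOL _ _ _ _ _ _); rewrite ?mulr1 ?mulr0.
Qed.

Lemma perm_mean_walk_bad B i : i \in OPT -> B \in F -> i \in B ->
  perm_mean p i (walk_bad B i) <=
  2 * (p + (1 - p) * ln (1 - p)) * (4 * p * (1 - p)) ^+ slack w mu OPT B i.
Proof.
move=> iO BF iB; have lt : (rank_in B i < mu B)%N.
  have [iOPT _ _] := is_optP (optP [set: U] [set: U]).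
  apply: leq_trans (indepP _ _ _ iOPT _ BF); apply: proper_card; apply/properP; split.
    by apply/subsetP => x; rewrite inE => /andP[].
  by exists i; rewrite !inE ?iO ?iB ?ltxx ?andbF.
have mE : mu B = ((slack w mu OPT B i).+1 + rank_in B i)%N.
  by rewrite /slack -/(rank_in B i); move: (rank_in B i) (mu B) lt => a b; clear; lia.
have ul : uniq (heavy_first B i) by rewrite sort_uniq enum_uniq.
have lB : {subset heavy_first B i <= B}.
  by move=> x; rewrite mem_sort mem_enum inE => /andP[].
have il : i \notin heavy_first B i by rewrite mem_sort mem_enum !inE eqxx.
have := perm_mean_walk p_gt0 p_lt c_lt BF mE ul lB il.
by rewrite mulrAC.
Qed.

Lemma kappa_ge0 : 0 <= p + (1 - p) * ln (1 - p).
Proof.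
have p1 : p < 1 by have := p_lt; lra.
have p01 : (0 < p < 1)%Re by split; apply/RltP.
apply/RleP; apply: (is_RInt_ge_0 _ _ _ _ _ (is_RInt_ratio p01)).
  by apply/RleP/ltW.
move=> y [/RltP y0 /RltP yp]; apply/RleP; rewrite RdivE.
have y0' : 0 < y := y0.
have h : 0 < 1 - p + y by have := p1; have := y0'; lra.
exact: divr_ge0 (ltW y0') (ltW h).
Qed.

Lemma expected_wSOL_ge (c := 4 * p * (1 - p)) :
  (p - 4 * (p + (1 - p) * ln (1 - p)) / (1 - c) ^+ 2) * \sum_(i in OPT) w i
  <= expected_wSOL w F mu opt p.
Proof.
set kappa := p + (1 - p) * ln (1 - p); have k0 : 0 <= kappa := kappa_ge0.
apply: le_trans expected_ge_sum.
have c0 : 0 <= c by rewrite !mulr_ge0 ?(ltW p_gt0) //; have := p_lt; lra.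
have c1 : c < 1 by have := c_lt; rewrite -/c; lra.
have [iOPT _ _] := is_optP (optP [set: U] [set: U]).
have := weighted_slack lamF w_inj mu_mono w_ge0 c0 c1 iOPT.
have k2 : 0 <= 2 * kappa by rewrite mulr_ge0.
move/(ler_wpM2l k2) => h.
apply: (@le_trans _ _ (p * \sum_(i in OPT) w i - 2 * kappa *
   \sum_(i in OPT) w i * \sum_(B in F | i \in B) c ^+ slack w mu OPT B i)).
  rewrite mulrBl lerD2l lerN2; apply: le_trans h _.
  by rewrite le_eqVlt; apply/orP; left; apply/eqP; ring.
rewrite !mulr_sumr -sumrB; apply: ler_sum => i iO.
have -> : p * w i - 2 * kappa * (w i * \sum_(B in F | i \in B) c ^+ slack w mu OPT B i) =
   w i * (p - \sum_(B in F | i \in B) 2 * kappa * c ^+ slack w mu OPT B i).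
  by rewrite -mulr_sumr; ring.
apply: ler_wpM2l => //; rewrite lerD2l lerN2; apply: ler_sum => B /andP[BF iB].
exact: perm_mean_walk_bad.
Qed.

End Main.

Theorem theorem1 (U : finType) (w : U -> R) (F : {set {set U}})
    (mu : {set U} -> nat) (opt : {set U} -> {set U} -> {set U}) (p : R) :
  (forall x, (0 <= w x)%Re) ->
  injective w ->
  laminar F ->
  [set: U] \in F ->
  (forall A, A \in F -> (0 < mu A)%N) ->
  (forall A B, A \in F -> B \in F -> A \proper B -> (mu A < mu B)%N) ->
  (forall V B, is_opt w F mu V B (opt V B)) ->
  (0 < p < 1 / 2)%Re ->
  let alpha := ((p + (1 - p) * ln (1 - p)) / (2 * (1 - p) * p ^ 2))%Re in
  let c := (4 * p * (1 - p))%Re in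
  (c < 1 / 2)%Re ->
  (expected_wSOL w F mu opt p >=
     p * (1 - 2 * alpha * c / (1 - c) ^ 2) * wset w (opt [set: U] [set: U]))%Re.
Proof.
move=> w0 w_inj lamF setTF _ mono optP [p0 p2] alpha c c2.
have IZRE k : IZR (Z.of_nat k) = (k%:R)%R by rewrite -INRE INR_IZR_INZ.
have [one two four] := And3 (IZRE 1%N) (IZRE 2%N) (IZRE 4%N); rewrite /= in one two four.
have REs := (RmultE, RplusE, RminusE, RdivE, RpowE, one, two, four).
have w_ge0 x : (0 <= w x)%R by apply/RleP.
have p_gt0 : (0 < p)%R by apply/RltP.
have p_lt : (p < 2^-1)%R by move/RltP: p2; rewrite !REs; lra.
have cE : c = (4 * p * (1 - p))%R by rewrite /c !REs.
have c_lt : (4 * p * (1 - p) < 2^-1)%R by rewrite -cE; move/RltP: c2; rewrite !REs; lra.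
apply/Rle_ge/RleP.
have := expected_wSOL_ge lamF setTF w_ge0 w_inj mono optP p_gt0 p_lt c_lt.
rewrite -cE wsetE; congr (_ <= _)%R; rewrite !REs; congr (_ * _)%R.
have c1 : (1 - c != 0)%R by apply: lt0r_neq0; rewrite cE; lra.
rewrite /alpha !REs {2}cE; move: c1; move: (1 - c)%R (ln _) => d k d0.
have p1 : (1 - p != 0)%R by apply: lt0r_neq0; lra.
by field; rewrite d0 p1 lt0r_neq0.
Qed.
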